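(* Let $\mathcal{R}\subset\mathbb{C}^n$ be a bounded complete Reinhardt domain. If $f\in H^1(\mathcal{R})$ and $S_Nf$ denotes the square partial sum of $f$, then $$\left\|S_Nf-f\right\|_{A^1(\mathcal{R})}\longrightarrow 0\qquad\text{as } N\to\infty.$$
   Context: A domain $\Omega\subset\mathbb{C}^n$ is a complete Reinhardt domain if $(z_1,\dots,z_n)\in\Omega$ implies $(\lambda_1z_1,\dots,\lambda_nz_n)\in\Omega$ for all $\lambda_k\in\mathbb{C}$ with $|\lambda_k|<1$, $k=1,\dots,n$. Let $\mathcal{O}(\mathcal{R})$ be the set of holomorphic functions on $\mathcal{R}$. Each $f\in\mathcal{O}(\mathcal{R})$ has a power series expansion $f(z)=\sum_{\alpha\in\mathbb{N}^n}a_\alpha z^\alpha$ (multi-index notation, $\mathbb{N}$ containing $0$), converging uniformly on compact subsets of $\mathcal{R}$. For $\alpha\in\mathbb{N}^n$ put $|\alpha|_\infty=\max\{\alpha_1,\dots,\alpha_n\}$. The square partial sum of $f$ is $$S_Nf(z)=\sum_{|\alpha|_\infty\le N}a_\alpha z^\alpha .$$ Let $\mathbb{T}^n=\{z\in\mathbb{C}^n:|z_j|=1,\ j=1,\dots,n\}$. For $\bm{r}=(r_1,\dots,r_n)$ with all $r_j>0$ and $\bm{\theta}=(\theta_1,\dots,\theta_n)\in\mathbb{R}^n$, write $\bm{r}\cdot e^{i\bm{\theta}}=(r_1e^{i\theta_1},\dots,r_ne^{i\theta_n})$ and $\bm{r}\cdot\mathbb{T}^n=\{\bm{r}\cdot e^{i\bm{\theta}}: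 e^{i\bm{\theta}}\in\mathbb{T}^n\}$. Let $\mathcal{F}=\{\bm{r}:\bm{r}\cdot\mathbb{T}^n\subset\mathcal{R}\}$. The Hardy space $H^1(\mathcal{R})$ is the set of $f\in\mathcal{O}(\mathcal{R})$ with $$\|f\|_{H^1(\mathcal{R})}=\sup_{\bm{r}\in\mathcal{F}}\int_{\mathbb{T}^n}|f(\bm{r}\cdot e^{i\bm{\theta}})|\,d\theta_1\cdots d\theta_n<\infty$$ (each $\theta_j$ ranging over $[0,2\pi]$). The Bergman space $A^1(\mathcal{R})$ is the set of $f\in\mathcal{O}(\mathcal{R})$ with $\|f\|_{A^1(\mathcal{R})}=\int_{\mathcal{R}}|f|\,dV<\infty$, where $dV$ is Lebesgue measure on $\mathbb{C}^n$. *)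

(* Defs.v *)
From HB Require Import structures.
From mathcomp Require Import all_boot all_order all_algebra.
From mathcomp Require Import finmap complex.
From mathcomp Require Import all_classical all_reals all_analysis.

Set Implicit Arguments.
Unset Strict Implicit.
Unset Printing Implicit Defensive.

Import Order.TTheory GRing.Theory Num.Theory.
Import numFieldNormedType.Exports.

Local Open Scope classical_set_scope.
Local Open Scope ring_scope.

Lemma sigma_finite_product d1 d2 (T1 : measurableType d1)
    (T2 : measurableType d2) (R : realType)
    (mu : {sigma_finite_measure set T1 -> \bar R})
    (nu : {sigma_finite_measure set T2 -> \bar R}) :
  sigma_finite setT (mu \x nu)%E.
Proof.
have /sigma_finiteP[F [TF ndF Foo]] := sigma_finiteT mu.
have /sigma_finiteP[G [TG ndG Goo]] := sigma_finiteT nu.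
exists (fun k => F k `*` G k).
  apply/esym; rewrite -subTset => -[x y] _.
  have [i _ Fx] : (\bigcup_k F k) x by rewrite -TF.
  have [j _ Gy] : (\bigcup_k G k) y by rewrite -TG.
  exists (maxn i j) => //; split => /=.
  - by move: x Fx; exact/subsetPset/ndF/leq_maxl.
  - by move: y Gy; exact/subsetPset/ndG/leq_maxr.
move=> k; have [mF Fk] := Foo k; have [mG Gk] := Goo k; split.
  exact: measurableX.
by rewrite product_measure1E// lte_mul_pinfty// ge0_fin_numE.
Qed.

Section PowerMeasure.
Context d (T : measurableType d) (R : realType).

Definition cons_pair n (x : T * n.-tuple T) : n.+1.-tuple T :=
  [tuple of x.1 :: x.2].

Lemma measurable_cons_pair n :
  measurable_fun [set: T * n.-tuple T] (@cons_pair n).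
Proof. exact: measurable_cons. Qed.

Section Step.
Variables (mu : {sigma_finite_measure set T -> \bar R}) (n : nat).
Variable mun : {sigma_finite_measure set (n.-tuple T) -> \bar R}.

Definition power_step : set (n.+1.-tuple T) -> \bar R :=
  pushforward (mu \x mun)%E (@cons_pair n).

HB.instance Definition _ := Measure.copy power_step
  (measure_function_pushforward__canonical__measure_function_Measure
     (mu \x mun)%E (@measurable_cons_pair n)).

Let power_step_sigma_finite : sigma_finite setT power_step.
Proof.
pose unc (t : n.+1.-tuple T) := (thead t, [tuple of behead t]).
have uncK x : unc (cons_pair x) = x.
  by case: x => x t; rewrite /unc /cons_pair theadE; congr pair; exact/val_inj.
have munc : measurable_fun setT unc.
  by apply/measurable_fun_pairP; split;
    [exact: measurable_tnth | exact: measurable_behead].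
have [F TF Foo] := sigma_finite_product mu mun.
exists (fun k => unc @^-1` F k); first by rewrite -preimage_bigcup -TF.
move=> k; have [mF Fk] := Foo k; split.
  by rewrite -[X in measurable X]setTI; exact: munc.
rewrite /power_step /pushforward -comp_preimage.
by rewrite (_ : unc \o _ = id); [rewrite preimage_id | exact/funext].
Qed.

HB.instance Definition _ :=
  Measure_isSigmaFinite.Build _ _ _ power_step power_step_sigma_finite.

End Step.

Fixpoint power_measure (mu : {sigma_finite_measure set T -> \bar R}) (n : nat) :
    {sigma_finite_measure set (n.-tuple T) -> \bar R} :=
  match n with
  | 0 => \d_([tuple] : 0.-tuple T)
  | m.+1 => power_step mu (power_measure mu m)
  end.

Lemma power_measureE (mu : {sigma_finite_measure set T -> \bar R}) n
    (A : 'I_n -> set T) : (forall i, measurable (A i)) ->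
  power_measure mu n [set t | forall i, A i (tnth t i)] =
  (\prod_(i < n) mu (A i))%E.
Proof.
elim: n A => [|n IH] A mA.
  by rewrite big_ord0 /= diracE mem_set// => -[].
rewrite big_ord_recl -(IH (fun i => A (lift ord0 i)))//= /power_step /pushforward.
rewrite -product_measure1E//=; last first.
  rewrite (_ : [set _ | _] = \bigcap_(i in [set: 'I_n])
      ((@tnth n T)^~ i @^-1` A (lift ord0 i))).
    apply: fin_bigcap_measurable => // i _.
    by rewrite -[X in measurable X]setTI; exact: measurable_tnth.
  by apply/seteqP; split=> t /= H i => [_|]; exact: H.
congr product_measure1; apply/seteqP; split => -[x t] /=.
  move=> H; split; first by have := H ord0.
  by move=> i; have := H (lift ord0 i); rewrite tnthS.
move=> [Ax At] i; case: (unliftP ord0 i) => [j|] ->; last exact: Ax.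
by rewrite tnthS.
Qed.

End PowerMeasure.

Section Plane.
Variable R : realType.

Definition plane_lebesgue : set (measurableTypeR R * measurableTypeR R) -> \bar R :=
  ((@lebesgue_measure R) \x (@lebesgue_measure R))%E.

HB.instance Definition _ := Measure.on plane_lebesgue.
HB.instance Definition _ := Measure_isSigmaFinite.Build _ _ _ plane_lebesgue
  (sigma_finite_product (@lebesgue_measure R) (@lebesgue_measure R)).

End Plane.

(* The copy [R[i]^o] of [R[i]] is the one that carries the normed module
   structure; consequently [differentiable] below is complex differentiability. *)
Notation cvec R n := ('rV[R[i]^o]_n).

Section Reinhardt.
Context (R : realType) (n : nat).
Implicit Types (D : set (cvec R n)) (f : cvec R n -> R[i]^o).

Definition domain D := [/\ D !=set0, open D & connected D].

Definition complete_Reinhardt D :=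
  domain D /\
  forall z lam : cvec R n, D z -> (forall k, `|lam ord0 k| < 1) ->
    D (\row_k (lam ord0 k * z ord0 k)).

Definition holomorphic D f := forall z, D z -> differentiable f z.

Definition multi_index := {ffun 'I_n -> nat}.

Definition mi_norm (al : multi_index) : nat := \max_(j < n) al j.

Definition monomial (al : multi_index) (z : cvec R n) : R[i] :=
  \prod_(j < n) z ord0 j ^+ al j.

(* [f(z) = \sum_al a_al z^al] uniformly on the compact subsets of [D].  As the
   index set [N^n] is not ordered, convergence is that of the net of all finite
   partial sums. *)
Definition power_series_expansion D f (a : multi_index -> R[i]) :=
  forall K : set (cvec R n), compact K -> K `<=` D ->
  forall e : R, 0 < e ->
  exists A0 : {fset multi_index}, forall A : {fset multi_index},
    (A0 `<=` A)%fset -> forall z, K z ->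
    `|\sum_(al <- A) a al * monomial al z - f z| < e%:C%C.

Definition square_partial_sum (a : multi_index -> R[i]) (N : nat)
    (z : cvec R n) : R[i]^o :=
  \sum_(al \in [set al | (mi_norm al <= N)%N]) a al * monomial al z.

Definition polar (r th : n.-tuple R) : cvec R n :=
  \row_j ((tnth r j)%:C%C * (cos (tnth th j) +i* sin (tnth th j))%C).

Definition admissible_radii D : set (n.-tuple R) :=
  [set r | (forall j, 0 < tnth r j) /\ range (polar r) `<=` D].

Definition cube : set (n.-tuple R) :=
  [set th | forall j, tnth th j \in `[0, 2 * pi]].

Definition modulus (w : R[i]) : R := complex.Re `|w|.

Definition Hardy1_norm D f : \bar R :=
  ereal_sup [set \int[power_measure (@lebesgue_measure R) n]_(th in cube)
                   (modulus (f (polar r th)))%:E | r in admissible_radii D]%E.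

Definition Hardy1 D : set (cvec R n -> R[i]^o) :=
  [set f | holomorphic D f /\ (Hardy1_norm D f < +oo)%E].

(* [dV] is the n-fold product of Lebesgue measure on the real plane, the point
   [(x_j, y_j)_j] being identified with [(x_j + i y_j)_j]. *)
Definition of_real_coords (t : n.-tuple (R * R)) : cvec R n :=
  \row_j ((tnth t j).1 +i* (tnth t j).2)%C.

Definition Bergman1_norm D f : \bar R :=
  (\int[power_measure (@plane_lebesgue R) n]_(t in of_real_coords @^-1` D)
     (modulus (f (of_real_coords t)))%:E)%E.

End Reinhardt.

(* Main.v *)
Require Import Defs.
From mathcomp Require Import all_boot all_order all_algebra.
From mathcomp Require Import finmap complex ring lra.
From mathcomp Require Import all_classical all_reals all_analysis measurable_realfun.

Set Implicit Arguments.
Unset Strict Implicit.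
Unset Printing Implicit Defensive.

Import Order.TTheory GRing.Theory Num.Theory.
Import numFieldNormedType.Exports.

Local Open Scope classical_set_scope.
Local Open Scope ring_scope.

(** Square partial sums are not uniformly bounded on the torus in L^1 norm, since
    the kernels that produce them have logarithmically growing norms; but an
    integral over the domain can afford logarithms.

    Let [r] be an admissible polyradius and [z] a point with [|z_j| <= q r_j],
    [q < 1].  The values of [f] on the torus of radius [r] determine [S_N f] on the
    torus through [z]: one convolves in each variable with the kernel
    [sum_(k <= N) p^k e^(-ikx)], [p = |z_j| / r_j].  This kernel is at most
    [2 / |1 - p e^(-ix)|], so its L^1 mean is of order [ln (1 / (1 - q))] whatever
    [N] is ([sum_modulus_trunc_kernel]).  Hence the mean of [|S_N f|] over the torus
    through [z] is at most a constant times [(1 + ln (1 / (1 - q)))^n] times the Hardy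
    norm of [f] ([mean_partial_sum_le]), and so is the mean of [|S_N f - f|]
    ([mean_error_le]).  For fixed [z] the latter tends to [0], because the series
    converges uniformly on the torus through [z] ([mean_error_cvg]).

    The points [z] that admit such an [r] form the dilate [q D] ([dilatedP]), and the
    volume of [D \ qD] is [1 - q^(2n)] times that of [D].  For [q = 1 - 2^-k] the bound
    on the mean is polynomial in [k] while the volume left over is of order [2^-k]
    ([volume_shell_le]), so the means are dominated by an integrable function
    ([integrable_majorant]) and their integrals over [D] tend to [0] by dominated
    convergence.

    These integrals are [(2 pi)^n] times the Bergman norms ([Bergman1_average]): volume
    is invariant under independent rotations of the coordinates, and averaging over
    these rotations takes the place of polar coordinates.  The convolution is carried
    out as a finite average over roots of unity, which is exact on polynomials of
    small degree ([average_polynomial]); it is applied to a partial sum of the series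
    that is uniformly close to [f] on the torus ([partial_sum_le_average]). *)

(** * Coordinatewise maps of product measures *)

Section CoordinatewiseMaps.
Context d (T : measurableType d) (R : realType).
Local Open Scope ereal_scope.

Definition tuple_map n (phi : 'I_n -> T -> T) (t : n.-tuple T) : n.-tuple T :=
  [tuple phi i (tnth t i) | i < n].

Lemma measurable_tuple_map n (phi : 'I_n -> T -> T) :
  (forall i, measurable_fun setT (phi i)) ->
  measurable_fun setT (tuple_map phi).
Proof.
move=> mphi; apply/measurable_fun_tnthP => i.
rewrite (_ : _ \o _ = phi i \o (@tnth n T)^~ i); last first.
  by apply/funext => t /=; rewrite tnth_mktuple.
apply: measurableT_comp; [exact: mphi|exact: measurable_tnth].
Qed.

(** Stated on preimages: an invertible [phi] multiplies measures by [1 / c], so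
    that [x |-> q^-1 * x] has the constant [q]. *)
Definition scales_measure d' (T' : measurableType d')
    (mu : set T' -> \bar R) (c : R) (phi : T' -> T') :=
  forall A, measurable A -> mu (phi @^-1` A) = c%:E * mu A.

Lemma ge0_integral_scales_measure d' (T' : measurableType d')
    (mu : {measure set T' -> \bar R}) (c : {nonneg R}) (phi : T' -> T')
    (g : T' -> \bar R) :
  measurable_fun setT phi -> scales_measure mu c%:num phi ->
  measurable_fun setT g -> (forall x, 0 <= g x) ->
  \int[mu]_x g (phi x) = c%:num%:E * \int[mu]_x g x.
Proof.
move=> mphi smu mg g0.
rewrite -ge0_integral_mscale//.
have := @ge0_integral_pushforward _ _ _ _ R phi mphi mu setT g measurableT mg.
rewrite preimage_setT => <-; last by move=> x _; exact: g0.
by apply: eq_measure_integral => A mA _; exact: smu.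
Qed.

(** By Fubini: the fibre over [x] is transformed with a factor independent of
    [x].  Products of maps and shears are both of this form. *)
Lemma skew_product_scales d1 d2 (T1 : measurableType d1) (T2 : measurableType d2)
    (mu1 : {sigma_finite_measure set T1 -> \bar R})
    (mu2 : {sigma_finite_measure set T2 -> \bar R}) (c1 c2 : {nonneg R})
    (phi : T1 -> T1) (psi : T1 -> T2 -> T2) :
  measurable_fun setT phi -> scales_measure mu1 c1%:num phi ->
  (forall x, scales_measure mu2 c2%:num (psi x)) ->
  scales_measure (mu1 \x mu2) (c1%:num * c2%:num)%R
    (fun p => (phi p.1, psi p.1 p.2)).
Proof.
move=> mphi smu1 smu2 E mE.
set g := fun x => mu2 (xsection E x).
have mg : measurable_fun setT g by exact: measurable_fun_xsection.
transitivity (\int[mu1]_x (c2%:num%:E * g (phi x))).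
  rewrite {1}/product_measure1.
  apply: eq_integral => x _ /=; rewrite /g -(smu2 x); last exact: measurable_xsection.
  congr (mu2 _); apply/seteqP; split => t /=; by rewrite /xsection /= !inE.
rewrite ge0_integralZl//; last by apply: (measurableT_comp mg); exact: mphi.
rewrite (@ge0_integral_scales_measure _ _ mu1 c1 phi g)//.
by rewrite muleA -EFinM mulrC.
Qed.

(** The one lemma behind the three symmetries in use: rotations and dilations of
    the coordinates of C^n, and shifts of the angles of the torus. *)
Lemma power_measure_scales (mu : {sigma_finite_measure set T -> \bar R})
    (c : {nonneg R}) n (phi : 'I_n -> T -> T) :
  (forall i, measurable_fun setT (phi i)) ->
  (forall i, scales_measure mu c%:num (phi i)) ->
  scales_measure (power_measure mu n) (c%:num ^+ n)%R (tuple_map phi).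
Proof.
elim: n phi => [|n IH] phi mphi smu B mB.
  rewrite expr0 mul1e /=; congr (\d_ _ _); apply/seteqP.
  split => t /=; by rewrite (tuple0 (tuple_map _ _)) (tuple0 t).
pose phi' i := phi (lift ord0 i).
set E := @cons_pair _ T n @^-1` B.
have mE : measurable E.
  by rewrite -[E]setTI; exact: measurable_cons_pair.
have cE : @cons_pair _ T n @^-1` (tuple_map phi @^-1` B) =
    (fun p => (phi ord0 p.1, tuple_map phi' p.2)) @^-1` E.
  apply/seteqP; split=> -[x t]; rewrite /E /=; congr (B _); apply: eq_from_tnth => i;
    by rewrite tnth_mktuple; case: (unliftP ord0 i) => [j|] ->;
      rewrite ?tnthS ?tnth_mktuple //.
rewrite /= /power_step /pushforward -/E cE exprS.
have cn0 : (0 <= c%:num ^+ n)%R by [].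
have := @skew_product_scales _ _ _ _ mu (power_measure mu n) c (NngNum cn0)
  (phi ord0) (fun=> tuple_map phi') (mphi ord0) (smu ord0).
apply => // _.
by apply: IH => i; [exact: mphi|exact: smu].
Qed.

End CoordinatewiseMaps.

(** * Translations and dilations of the line *)

Section LineAndPlane.
Context (R : realType).
Local Notation lambda := (@lebesgue_measure R).
Local Notation TR := (measurableTypeR R).
Local Open Scope ereal_scope.

Lemma lebesgue_translation (a : R) :
  scales_measure lambda 1 ((fun x => x + a)%R : TR -> TR).
Proof.
move=> A mA; rewrite mul1e; apply/esym.
have mf : measurable_fun setT ((fun x => x + a)%R : TR -> TR).
  exact: measurable_funD.
apply: (@lebesgue_measure_unique _
  (measure_function_pushforward__canonical__measure_function_Measure lambda mf)) => //.
move=> X [[x y]] /= xy <-; rewrite /pushforward.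
rewrite (_ : _ @^-1` _ = `]x - a, y - a]%classic)%R; last first.
  by apply/seteqP; split => z /=; rewrite !in_itv /= ltrBlDr lerBrDr.
rewrite !lebesgue_measure_itv /= !lte_fin ltrD2r.
by case: ifP => // _; rewrite -!EFinD; congr EFin; ring.
Qed.

Lemma lebesgue_dilation (q : R) : (0 < q)%R ->
  scales_measure lambda q ((fun x => q^-1 * x)%R : TR -> TR).
Proof.
move=> q0 A mA.
have mf : measurable_fun setT ((fun x => q^-1 * x)%R : TR -> TR).
  exact: measurable_funM.
have q0' : (0 <= q^-1)%R by rewrite invr_ge0 ltW.
pose Q := NngNum q0'.
pose mu' := mscale Q
  (measure_function_pushforward__canonical__measure_function_Measure lambda mf).
suff -> : lambda A = mu' A.
  by rewrite /mu' /mscale /= muleA -EFinM mulfV ?gt_eqF// mul1e.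
apply: lebesgue_measure_unique => //.
move=> X [[x y]] /= xy <-; rewrite /mu' /mscale /= /pushforward.
rewrite (_ : _ @^-1` _ = `]q * x, q * y]%classic)%R; last first.
  by apply/seteqP; split => z /=; rewrite !in_itv /= ltr_pdivlMl// ler_pdivrMl.
rewrite !lebesgue_measure_itv /= !lte_fin ltr_pM2l//.
case: ifP => // _; last by rewrite mule0.
rewrite -!EFinD -EFinM; congr EFin; field; exact: lt0r_neq0.
Qed.

End LineAndPlane.

(** * Rotations and dilations of the plane *)

Section PlaneMaps.
Context (R : realType).
Local Notation lambda := (@lebesgue_measure R).
Local Notation TR := (measurableTypeR R).
Local Notation area := (@plane_lebesgue R).
Local Open Scope ereal_scope.

Lemma preserves_measure_comp d (T : measurableType d) (mu : set T -> \bar R)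
    (phi psi : T -> T) :
  measurable_fun setT phi ->
  scales_measure mu 1 phi -> scales_measure mu 1 psi ->
  scales_measure mu 1 (phi \o psi).
Proof.
move=> mphi s1 s2 A mA.
rewrite comp_preimage s2; last by rewrite -[X in measurable X]setTI; exact: mphi.
by rewrite s1// !mul1e.
Qed.

Lemma plane_swap_preserves : scales_measure area 1 (@unstable.swap TR TR).
Proof.
move=> A mA; rewrite mul1e; apply/esym.
apply: (@product_measure_unique _ _ _ _ _ lambda lambda
  (measure_function_pushforward__canonical__measure_function_Measure
    (lambda \x lambda) (@measurable_swap _ _ TR TR))) => //.
move=> X Y mX mY; rewrite /= /pushforward.
rewrite (_ : _ @^-1` _ = Y `*` X); last by apply/seteqP; split => -[x y] [].
by rewrite product_measure1E// muleC.
Qed.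

Definition shear (a : R) (p : TR * TR) : TR * TR := (p.1, p.2 + p.1 * a)%R.

Lemma measurable_shear a : measurable_fun setT (shear a).
Proof.
apply/measurable_fun_pairP; split; first exact: measurable_fst.
apply: measurable_funD; first exact: measurable_snd.
by apply: measurable_funM => //; exact: measurable_fst.
Qed.

Lemma shear_preserves a : scales_measure area 1 (shear a).
Proof.
have := @skew_product_scales _ _ _ _ _ lambda lambda (1%:nng)%R (1%:nng)%R id
  (fun x y => y + x * a)%R (@measurable_id _ _ _).
rewrite /= mulr1; apply; first by move=> A _; rewrite mul1e.
by move=> x; exact: lebesgue_translation.
Qed.

Definition plane_rotation (c s : R) (p : TR * TR) : TR * TR :=
  (c * p.1 - s * p.2, s * p.1 + c * p.2)%R.

Lemma measurable_plane_rotation c s : measurable_fun setT (plane_rotation c s).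
Proof.
apply/measurable_fun_pairP; split.
  by apply: measurable_funB; apply: measurable_funM.
by apply: measurable_funD; apply: measurable_funM.
Qed.

(** A rotation is a product of three shears, with coefficients [- t], [s], [- t]
    for [t = s / (1 + c)] the tangent of the half angle, and a shear translates
    every fibre. *)
Lemma plane_rotation_preserves c s : (c ^+ 2 + s ^+ 2 = 1)%R ->
  scales_measure area 1 (plane_rotation c s).
Proof.
have mS := @measurable_swap _ _ TR TR.
have pS := plane_swap_preserves.
have key c' s' : (c' ^+ 2 + s' ^+ 2 = 1 -> 1 + c' != 0)%R ->
    (c' ^+ 2 + s' ^+ 2 = 1)%R -> scales_measure area 1 (plane_rotation c' s').
  move=> /[swap] cs /(_ cs) c1; pose t := (s' / (1 + c'))%R.
  pose H := @unstable.swap TR TR \o (shear (- t) \o @unstable.swap TR TR).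
  have mH : measurable_fun setT H.
    by apply: measurableT_comp => //; apply: measurableT_comp => //; exact: measurable_shear.
  have pH : scales_measure area 1 H.
    apply: preserves_measure_comp => //; apply: preserves_measure_comp => //.
    - exact: measurable_shear.
    - exact: shear_preserves.
  have -> : plane_rotation c' s' = H \o (shear s' \o H).
    apply/funext => -[x y]; rewrite /H /shear /plane_rotation /unstable.swap /=.
    have ts : (1 - t * s' = c')%R.
      have -> : (t * s' = s' ^+ 2 / (1 + c'))%R by rewrite /t; field.
      have -> : (s' ^+ 2 = (1 - c') * (1 + c'))%R by move: cs; lra.
      by rewrite mulfK//; ring.
    have t1 : (t * (1 + c') = s')%R by rewrite /t mulfVK.
    congr pair.
      transitivity ((1 - t * s') * x - (t * (1 + (1 - t * s'))) * y)%R; last by ring.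
      by rewrite ts t1.
    transitivity (s' * x + (1 - t * s') * y)%R; first by rewrite ts.
    by ring.
  apply: preserves_measure_comp => //; apply: preserves_measure_comp => //.
    exact: measurable_shear.
  exact: shear_preserves.
have [c1|c1 cs] := eqVneq (1 + c)%R 0%R; last exact: key.
(* the half turn, which no product of three such shears reaches *)
move=> cs; have cN1 : c = (- 1)%R by lra.
have s0 : s = 0%R.
  by apply/eqP; rewrite -sqrf_eq0; apply/eqP; move: cs; rewrite cN1; lra.
have q : scales_measure area 1 (plane_rotation 0 1).
  have h : (0 ^+ 2 + 1 ^+ 2 = 1 :> R)%R by rewrite expr0n expr1n add0r.
  apply: (key 0%R 1%R _ h) => _.
  by rewrite addr0 oner_neq0.
have -> : plane_rotation c s = plane_rotation 0 1 \o plane_rotation 0 1.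
  by apply/funext => -[x y]; rewrite /plane_rotation /= cN1 s0; congr pair; lra.
apply: preserves_measure_comp => //; exact: measurable_plane_rotation.
Qed.

Definition plane_dilation (q : R) (p : TR * TR) : TR * TR :=
  (q^-1 * p.1, q^-1 * p.2)%R.

Lemma measurable_plane_dilation q : measurable_fun setT (plane_dilation q).
Proof.
apply/measurable_fun_pairP; split; exact: measurable_funM.
Qed.

Lemma plane_dilation_scales q : (0 < q)%R ->
  scales_measure area (q ^+ 2)%R (plane_dilation q).
Proof.
move=> q0; have q0' := ltW q0.
have mq : measurable_fun setT ((fun x => q^-1 * x)%R : TR -> TR) by exact: measurable_funM.
have := @skew_product_scales _ _ _ _ _ lambda lambda (NngNum q0') (NngNum q0')
  (fun x => q^-1 * x)%R (fun _ y => q^-1 * y)%R mq (lebesgue_dilation q0).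
by apply => _; exact: lebesgue_dilation.
Qed.

End PlaneMaps.

(** * Turns of the circle of angles *)

Section CircleTurn.
Context (R : realType).
Local Notation lambda := (@lebesgue_measure R).
Local Notation TR := (measurableTypeR R).
Local Open Scope ereal_scope.

(** The addition of [a] modulo [2 * pi], extended by the identity outside
    [[0, 2 * pi]] so that it preserves Lebesgue measure on the whole line. *)
Definition turn (a x : TR) : TR :=
  (if (0 <= x) && (x <= 2 * pi) then
     if x <= 2 * pi - a then x + a else x + a - 2 * pi else x)%R.

Lemma measurable_turn a : measurable_fun setT (turn a).
Proof.
have mle (c d : TR -> TR) : measurable_fun setT c -> measurable_fun setT d ->
    measurable_fun setT (fun x => c x <= d x)%R.
  by move=> mc md; exact: measurable_fun_ler.
apply: measurable_fun_ifT => //.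
  by apply: measurable_and; apply: mle.
apply: measurable_fun_ifT; first exact: mle.
  exact: measurable_funD.
by apply: measurable_funB => //; exact: measurable_funD.
Qed.

(** Apart from the negligible point [0], [turn] cuts the half-open interval in two
    and exchanges the pieces by translations. *)
Lemma turn_preserves (a : R) : (0 <= a < 2 * pi)%R ->
  scales_measure lambda 1 (turn a).
Proof.
move=> /andP[a0 a2] A mA; rewrite mul1e.
have pi0 := pi_gt0 R.
pose I1 : set TR := `]0, (2 * pi - a)]%classic%R.
pose I2 : set TR := `](2 * pi - a), (2 * pi)]%classic%R.
pose J1 : set TR := `]a, (2 * pi)]%classic%R.
pose J2 : set TR := `]0, a]%classic%R.
pose K : set TR := ~` `]0, (2 * pi)]%classic%R.
pose s1 (x : TR) : TR := (x + a)%R.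
pose s2 (x : TR) : TR := (x + (a - 2 * pi))%R.
have m1 : measurable_fun setT s1 by exact: measurable_funD.
have m2 : measurable_fun setT s2 by exact: measurable_funD.
have mI1 : measurable I1 by exact: measurable_itv.
have mI2 : measurable I2 by exact: measurable_itv.
have mJ1 : measurable J1 by exact: measurable_itv.
have mJ2 : measurable J2 by exact: measurable_itv.
have mK : measurable K by apply: measurableC; exact: measurable_itv.
have mp1 B : measurable B -> measurable (s1 @^-1` B).
  by move=> mB; rewrite -[X in measurable X]setTI; exact: m1.
have mp2 B : measurable B -> measurable (s2 @^-1` B).
  by move=> mB; rewrite -[X in measurable X]setTI; exact: m2.
have E1 : s1 @^-1` (A `&` J1) = s1 @^-1` A `&` I1.
  by apply/seteqP; split => x; rewrite /I1 /J1 /s1 /= !in_itv /= => -[? /andP[? ?]];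
    split => //; apply/andP; split; lra.
have E2 : s2 @^-1` (A `&` J2) = s2 @^-1` A `&` I2.
  by apply/seteqP; split => x; rewrite /I2 /J2 /s2 /= !in_itv /= => -[? /andP[? ?]];
    split => //; apply/andP; split; lra.
have add3 X Y Z : measurable X -> measurable Y -> measurable Z ->
    X `&` Y = set0 -> (X `|` Y) `&` Z = set0 ->
    lambda X + lambda Y + lambda Z = lambda (X `|` Y `|` Z).
  by move=> mX mY mZ XY XYZ; rewrite -measureU// -measureU//; exact: measurableU.
have -> : lambda A = lambda (A `&` J1) + lambda (A `&` J2) + lambda (A `&` K).
  rewrite add3; try exact: measurableI.
  - congr (lambda _); rewrite -!setIUr; apply/esym/setIidPl => x _.
    rewrite /K /J1 /J2 /= !in_itv /=.
    have [|] := boolP ((0 < x) && (x <= 2 * pi))%R => [/andP[x0 x1]|]; last by right; apply/negP.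
    by left; have [?|?] := leP x a; [right|left]; apply/andP.
  - apply/seteqP; split => x //=; rewrite /J1 /J2 /= !in_itv /= => -[[_ /andP[? ?]]] [_ /andP[? ?]]; lra.
  - apply/seteqP; split => x //=; rewrite /K /J1 /J2 /= !in_itv /=.
    move=> [[] [_ /andP[? ?]] [_]]; apply; apply/andP; split; lra.
rewrite -[lambda (A `&` J1)]mul1e -[lambda (A `&` J2)]mul1e.
rewrite -(@lebesgue_translation _ a _ (measurableI _ _ mA mJ1)).
rewrite -(@lebesgue_translation _ (a - 2 * pi)%R _ (measurableI _ _ mA mJ2)) -/s1 -/s2.
rewrite E1 E2.
set U := s1 @^-1` A `&` I1 `|` s2 @^-1` A `&` I2 `|` A `&` K.
have -> : lambda (s1 @^-1` A `&` I1) + lambda (s2 @^-1` A `&` I2) + lambda (A `&` K) = lambda U.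
  rewrite add3//.
  - by apply: measurableI => //; exact: mp1.
  - by apply: measurableI => //; exact: mp2.
  - exact: measurableI.
  - apply/seteqP; split => x //=; rewrite /I1 /I2 /= !in_itv /= => -[[_ /andP[? ?]]] [_ /andP[? ?]]; lra.
  - apply/seteqP; split => x //=; rewrite /K /I1 /I2 /= !in_itv /=.
    move=> [[] [_ /andP[? ?]] [_]]; apply; apply/andP; split; lra.
have mU : measurable U.
  by apply: measurableU; [apply: measurableU|]; apply: measurableI => //; [exact: mp1|exact: mp2].
have m0 : measurable [set 0%R : TR] by exact: measurable_set1.
(* the point [0] is the only one where [turn] differs from the exchange of intervals *)
have l0 (X : set TR) : measurable X -> lambda (X `\` [set 0%R]) = lambda X.
  move=> mX; rewrite -[in RHS](setUIDK X [set 0%R : TR]) measureU//.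
  - rewrite [X in _ = X + _](_ : _ = 0) ?add0e//.
    apply: (@subset_measure0 _ _ _ lambda _ [set 0%R : TR]) => //.
    + exact: measurableI.
    + exact: lebesgue_measure_set1.
  - exact: measurableI.
  - exact: measurableD.
  - by apply/seteqP; split=> x //= [[_ ?]] [_].
have mt : measurable (turn a @^-1` A).
  by rewrite -[X in measurable X]setTI; exact: measurable_turn.
rewrite -[LHS]l0// -[RHS]l0//; congr (lambda _).
apply/seteqP; split => x; rewrite /U /turn /I1 /I2 /K /s1 /s2 /= !in_itv /= => -[+ /eqP x0].
  case: ifPn => [/andP[x1 x2]|xn]; last first.
    move=> Ax; split; last exact/eqP.
    by right; split => // /andP[x1 x2]; case/negP: xn; apply/andP; split; lra.
  case: ifPn => [x3|]; last rewrite -ltNge => x3.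
    move=> Ax; split; last exact/eqP.
    by left; left; split => //; apply/andP; split => //; rewrite lt_def x0.
  rewrite -addrA => Ax; split; last exact/eqP.
  by left; right; split => //; apply/andP.
move=> Ux; split; last exact/eqP.
case: Ux => [[[Ax /andP[x1 x2]]|[Ax /andP[x1 x2]]]|[Ax xn]].
- by rewrite ifT ?ifT//; apply/andP; split; lra.
- rewrite ifT; last by apply/andP; split; lra.
  by rewrite ifF -?addrA//; apply/negP => ?; lra.
- case: ifPn => // /andP[x1 x2]; exfalso; apply: xn; apply/andP; split => //.
  by rewrite lt_def x0.
Qed.

End CircleTurn.

(** * Modulus and argument of complex numbers *)

Section Modulus.
Context (R : realType).
Implicit Types (w : R[i]) (x y e : R).

Lemma modulusE w : `|w| = (modulus w)%:C%C.
Proof. by rewrite /modulus normc_def. Qed.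

Lemma modulus_sqrt w :
  modulus w = Num.sqrt (complex.Re w ^+ 2 + complex.Im w ^+ 2).
Proof. by rewrite /modulus normc_def. Qed.

Lemma modulus_ge0 w : 0 <= modulus w.
Proof. by rewrite modulus_sqrt sqrtr_ge0. Qed.

Lemma modulus_lt w e : (`|w| < e%:C%C) = (modulus w < e).
Proof. by rewrite modulusE ltcR. Qed.

Lemma ler_modulusD w1 w2 : modulus (w1 + w2) <= modulus w1 + modulus w2.
Proof. by have := ler_normD w1 w2; rewrite !modulusE -rmorphD lecR. Qed.

Lemma modulusM w1 w2 : modulus (w1 * w2) = modulus w1 * modulus w2.
Proof. by apply: complexI; rewrite rmorphM -!modulusE normrM. Qed.

Lemma modulusN w : modulus (- w) = modulus w.
Proof. by rewrite /modulus normrN. Qed.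

Lemma modulusB w1 w2 : modulus (w1 - w2) = modulus (w2 - w1).
Proof. by rewrite /modulus distrC. Qed.

Lemma modulus0 : modulus (0 : R[i]) = 0.
Proof. by rewrite /modulus normr0. Qed.

Lemma modulus1 : modulus (1 : R[i]) = 1.
Proof. by rewrite /modulus normr1. Qed.

Lemma modulusX w k : modulus (w ^+ k) = modulus w ^+ k.
Proof. by elim: k => [|k IH]; rewrite ?modulus1// !exprS modulusM IH. Qed.

Lemma modulus_eq0 w : (modulus w == 0) = (w == 0).
Proof. by rewrite -(inj_eq (@complexI R)) -modulusE normr_eq0. Qed.

Lemma modulusV w : modulus w^-1 = (modulus w)^-1.
Proof. by apply: complexI; rewrite fmorphV -!modulusE normfV. Qed.

Lemma modulus_real x : 0 <= x -> modulus (x%:C)%C = x.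
Proof. by move=> x0; rewrite modulus_sqrt /= expr0n addr0 sqrtr_sqr ger0_norm. Qed.

Lemma modulus_le_ReIm w :
  modulus w <= `|complex.Re w| + `|complex.Im w|.
Proof.
rewrite modulus_sqrt -(@ler_pXn2r _ 2)// ?nnegrE ?sqrtr_ge0 ?addr_ge0//.
rewrite sqr_sqrtr ?addr_ge0 ?sqr_ge0// sqrrD -!normrX !(ger0_norm (sqr_ge0 _)).
by rewrite addrAC lerDl mulrn_wge0// mulr_ge0.
Qed.

Lemma modulus_ge_Re w : `|complex.Re w| <= modulus w.
Proof. by have := normc_ge_Re w; rewrite modulusE lecR. Qed.

Lemma modulus_ge_Im w : `|complex.Im w| <= modulus w.
Proof.
rewrite modulus_sqrt -(@ler_pXn2r _ 2)// ?nnegrE ?sqrtr_ge0//.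
by rewrite sqr_sqrtr ?addr_ge0 ?sqr_ge0// real_normK ?num_real// lerDr sqr_ge0.
Qed.

Lemma ler_modulus_sum I (s : seq I) (P : pred I) (F : I -> R[i]) :
  modulus (\sum_(i <- s | P i) F i) <= \sum_(i <- s | P i) modulus (F i).
Proof.
elim/big_ind2 : _ => //; first by rewrite modulus0.
by move=> x1 x2 y1 y2 h1 h2; rewrite (le_trans (ler_modulusD _ _))// lerD.
Qed.

Lemma modulus_prod I (s : seq I) (F : I -> R[i]) :
  modulus (\prod_(i <- s) F i) = \prod_(i <- s) modulus (F i).
Proof.
by elim/big_ind2 : _ => //; [rewrite modulus1|move=> ? ? ? ? <- <-; rewrite modulusM].
Qed.

Definition cis x : R[i] := (cos x +i* sin x)%C.

Lemma cisD x y : cis (x + y) = cis x * cis y.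
Proof.
by apply/eqP; rewrite eq_complex /= cosD sinD; apply/andP; split; apply/eqP; ring.
Qed.

Lemma cis0 : cis 0 = 1.
Proof. by rewrite /cis cos0 sin0. Qed.

Lemma cis_muln x k : cis (x *+ k) = cis x ^+ k.
Proof. by elim: k => [|k IH]; rewrite ?cis0// mulrS cisD IH exprS. Qed.

Lemma cis2pi : cis (2 * pi) = 1.
Proof. by rewrite mulr_natl /cis cos2pi sin2pi. Qed.

Lemma modulus_cis x : modulus (cis x) = 1.
Proof. by rewrite modulus_sqrt /= cos2Dsin2 sqrtr1. Qed.

Lemma cis_surj w : modulus w = 1 -> exists2 x, 0 <= x < 2 * pi & w = cis x.
Proof.
case: w => a b; rewrite modulus_sqrt /= => ab1.
have pi0 := pi_gt0 R.
have {}ab1 : a ^+ 2 + b ^+ 2 = 1.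
  by rewrite -[LHS]sqr_sqrtr ?addr_ge0 ?sqr_ge0// ab1 expr1n.
have a1 : -1 <= a <= 1.
  have : `|a| ^+ 2 <= 1 ^+ 2 by rewrite real_normK ?num_real// expr1n -ab1 lerDl sqr_ge0.
  by rewrite ler_pXn2r ?nnegrE// ler_norml.
have sa : sin (acos a) = `|b|.
  by rewrite sin_acos// -ab1 addrC addKr sqrtr_sqr.
have ca : cos (acos a) = a by rewrite acosK// in_itv.
have l0 := acos_ge0 a1; have l1 := acos_lepi a1.
have [b0|b0] := leP 0 b.
  exists (acos a); first by apply/andP; split; lra.
  by rewrite /cis ca sa ger0_norm.
have ac0 : acos a != 0.
  by apply/eqP => a0; move: sa; rewrite a0 sin0 => /esym/eqP; rewrite normr_eq0 lt_eqF.
exists (2 * pi - acos a).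
  by rewrite gtrBl subr_ge0; apply/andP; split; [lra|rewrite lt_def ac0].
rewrite mulr_natl /cis cosB sinB cos2pi sin2pi ca sa ltr0_norm//.
by congr (_ +i* _)%C; ring.
Qed.

Lemma polar_form w : exists2 x, 0 <= x < 2 * pi & w = (modulus w)%:C%C * cis x.
Proof.
have [->|w0] := eqVneq w 0.
  exists 0; last by rewrite modulus0 mul0r.
  by rewrite lexx mulr_gt0// pi_gt0.
have m0 : modulus w != 0 by rewrite modulus_eq0.
have [|x xp wE] := @cis_surj (w / (modulus w)%:C%C).
  by rewrite modulusM modulusV modulus_real ?modulus_ge0// mulfV.
exists x => //; rewrite -wE mulrC mulfVK//.
by rewrite -modulus_eq0 modulus_real ?modulus_ge0.
Qed.

End Modulus.

(** * Tori, and preimages of open sets *)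

Section CoordinateTopology.
Context (R : realType) (n : nat).

(** Balls of the matrix space have radii in [R[i]]; this replaces them by real
    radii. *)
Lemma open_modulus_ball (D : set (cvec R n)) z : open D -> D z ->
  exists2 e : R, 0 < e & forall w : cvec R n,
    (forall j, modulus (z ord0 j - w ord0 j) < e) -> D w.
Proof.
move=> oD Dz; have := open_nbhs_nbhs (conj oD Dz).
move=> /nbhs_ballP [e /= e0 B]; move: (e0); rewrite ltcE /= => /andP[/eqP ei er].
exists (complex.Re e) => // w zw; apply: B; split => // i j; rewrite (ord1 i) /ball /= /ball_ /=.
by rewrite [e]complexE ei mulr0 addr0 modulus_lt.
Qed.

Lemma circle_compact (r : R) :
  compact [set ((r%:C)%C * cis x : R[i]^o) | x in `[0, 2 * pi]%classic].
Proof.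
apply: continuous_compact; last exact: segment_compact.
apply: continuous_subspaceT => x; apply/cvgrPdist_lt => e.
rewrite ltcE /= => /andP[/eqP ei er].
have r0 : 0 < `|r| + 1 by rewrite ltr_wpDl.
have e0 : 0 < complex.Re e / (2 * (`|r| + 1)) by rewrite divr_gt0// mulr_gt0.
have hc : \forall t \near x, `|cos x - cos t| < complex.Re e / (2 * (`|r| + 1)).
  by move/cvgrPdist_lt: (@continuous_cos R x); apply.
have hs : \forall t \near x, `|sin x - sin t| < complex.Re e / (2 * (`|r| + 1)).
  by move/cvgrPdist_lt: (@continuous_sin R x); apply.
apply: filterS2 hc hs => t hc hs.
rewrite [e]complexE ei mulr0 addr0 -mulrBr modulus_lt modulusM.
have -> : modulus (r%:C)%C = `|r|.
  by rewrite modulus_sqrt /= expr0n addr0 sqrtr_sqr.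
have le2 : modulus (cis x - cis t) <= `|cos x - cos t| + `|sin x - sin t|.
  exact: modulus_le_ReIm.
have : modulus (cis x - cis t) < complex.Re e / (`|r| + 1).
  apply: (le_lt_trans le2); apply: (lt_le_trans (ltrD hc hs)).
  by rewrite le_eqVlt; apply/orP; left; apply/eqP; field; rewrite gt_eqF.
rewrite ltr_pdivlMr// => h; apply: le_lt_trans h.
by rewrite mulrC ler_wpM2l ?modulus_ge0// lerDl.
Qed.

Lemma torus_compact (r : n.-tuple R) : compact (polar r @` @cube R n).
Proof.
rewrite (_ : _ @` _ = [set v : cvec R n | forall i,
   [set ((tnth r i)%:C%C * cis x : R[i]^o) | x in `[0, 2 * pi]%classic] (v ord0 i)]).
  apply: (@rV_compact R[i]^o n (fun i =>
    [set ((tnth r i)%:C%C * cis x : R[i]^o) | x in `[0, 2 * pi]%classic])) => i.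
  exact: circle_compact.
apply/seteqP; split => [_ [th cth <-] i|v /= H].
  by exists (tnth th i); [exact: cth|rewrite mxE].
have /choice[th thP] : forall i, exists x, x \in `[0, 2 * pi] /\
    (tnth r i)%:C%C * cis x = v ord0 i.
  by move=> i; have [x ? ?] := H i; exists x.
exists [tuple th i | i < n].
  by move=> i; rewrite tnth_mktuple; have [] := thP i.
by apply/rowP => i; rewrite mxE tnth_mktuple; have [_ <-] := thP i.
Qed.

Context d (T : measurableType d).
Implicit Type g : T -> cvec R n.

Definition coord_measurable g := forall j,
  measurable_fun setT (fun t => complex.Re (g t ord0 j)) /\
  measurable_fun setT (fun t => complex.Im (g t ord0 j)).

Definition rational_box (q : n.-tuple (rat * rat)) (k : nat) : set (cvec R n) :=
  [set w | forall j, `|complex.Re (w ord0 j) - ratr (tnth q j).1| < k.+1%:R^-1 /\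
                     `|complex.Im (w ord0 j) - ratr (tnth q j).2| < k.+1%:R^-1].

(** An open set is a union of boxes with rational centres and sizes, and there are
    countably many of those. *)
Lemma measurable_open_preimage (D : set (cvec R n)) g : open D ->
  coord_measurable g -> measurable (g @^-1` D).
Proof.
move=> oD mg.
pose B (p : n.-tuple (rat * rat) * nat) : set T :=
  [set t | rational_box p.1 p.2 `<=` D /\ rational_box p.1 p.2 (g t)].
have -> : g @^-1` D = \bigcup_p B p.
  apply/seteqP; split => [t /= Dt|t [p _ [sD pt]]]; last exact: sD.
  have [e e0 eD] := open_modulus_ball oD Dt.
  pose k := Num.truncn (4 / e); pose h : R := k.+1%:R^-1.
  have h0 : 0 < h by rewrite invr_gt0.
  have he : 4 * h < e.
    by rewrite /h ltr_pdivrMr// mulrC -ltr_pdivrMr// truncnS_gt.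
  have appr (x : R) : exists q : rat, `|x - ratr q| < h.
    have [|q] := @rat_in_itvoo R (x - h) (x + h); first by rewrite ltrD2l gtrN.
    by rewrite in_itv /= -ltr_distlC distrC => ?; exists q; rewrite distrC.
  have /choice[q qP] : forall j, exists q : rat * rat,
      `|complex.Re (g t ord0 j) - ratr q.1| < h /\
      `|complex.Im (g t ord0 j) - ratr q.2| < h.
    move=> j; have [q1 h1] := appr (complex.Re (g t ord0 j)).
    by have [q2 h2] := appr (complex.Im (g t ord0 j)); exists (q1, q2).
  exists ([tuple q j | j < n], k) => //; split => /=; last first.
    by move=> j; rewrite tnth_mktuple; exact: qP.
  move=> w wq; apply: eD => j; have := wq j; rewrite tnth_mktuple => -[w1 w2].
  have [t1 t2] := qP j.
  apply: (le_lt_trans (modulus_le_ReIm _)); apply: le_lt_trans he.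
  have -> : complex.Re (g t ord0 j - w ord0 j) =
    complex.Re (g t ord0 j) - complex.Re (w ord0 j).
    by case: (g t ord0 j) (w ord0 j) => ? ? [].
  have -> : complex.Im (g t ord0 j - w ord0 j) =
    complex.Im (g t ord0 j) - complex.Im (w ord0 j).
    by case: (g t ord0 j) (w ord0 j) => ? ? [].
  have l1 := ler_distD (ratr (q j).1) (complex.Re (g t ord0 j)) (complex.Re (w ord0 j)).
  have l2 := ler_distD (ratr (q j).2) (complex.Im (g t ord0 j)) (complex.Im (w ord0 j)).
  rewrite (distrC (ratr (q j).1)) in l1.
  rewrite (distrC (ratr (q j).2)) in l2.
  by move: w1 w2 t1 t2; rewrite -/h => *; lra.
apply: countable_bigcupT_measurable; first exact: countableP.
move=> [q k]; rewrite /B /=.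
have [sD|nD] := pselect (rational_box q k `<=` D); last first.
  by rewrite (_ : [set _ | _] = set0)//; apply/seteqP; split => // t [].
rewrite (_ : [set _ | _] = \bigcap_(j in [set: 'I_n])
    ((fun t => `|complex.Re (g t ord0 j) - ratr (tnth q j).1|) @^-1` `]-oo, k.+1%:R^-1[%classic `&`
     (fun t => `|complex.Im (g t ord0 j) - ratr (tnth q j).2|) @^-1` `]-oo, k.+1%:R^-1[%classic)).
  apply: fin_bigcap_measurable => // j _; have [m1 m2] := mg j.
  apply: measurableI; rewrite -[X in measurable X]setTI.
  - have m : measurable_fun setT (fun t => `|complex.Re (g t ord0 j) - ratr (tnth q j).1|).
      by apply: measurableT_comp => //; exact: measurable_funB.
    by apply: m => //; exact: measurable_itv.
  - have m : measurable_fun setT (fun t => `|complex.Im (g t ord0 j) - ratr (tnth q j).2|).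
      by apply: measurableT_comp => //; exact: measurable_funB.
    by apply: m => //; exact: measurable_itv.
apply/seteqP; split => t /=.
  by move=> [_ H] j _; rewrite /= !in_itv /=; have [] := H j.
by move=> H; split => // j; have := H j I; rewrite /= !in_itv.
Qed.

End CoordinateTopology.

(** * The truncated geometric kernel on roots of unity *)

Section Kernel.
Context (R : realType).
Implicit Types (p q x : R) (m N : nat).

Lemma cis_neq1 x : 0 < x < 2 * pi -> cis x != 1.
Proof.
move=> /andP[x0 x1]; apply/eqP => /(congr1 (@complex.Re R)) /= c1.
have s0 : 0 < sin (x / 2) by apply: sin_gt0_pi; apply/andP; split; lra.
have : cos x = 1 - sin (x / 2) ^+ 2 *+ 2.
  rewrite {1}(splitr x) -mulr2n cos_mulr2n cos2sin2; ring.
rewrite c1 => /eqP; rewrite eq_sym subr_eq addrC -subr_eq subrr eq_sym mulrn_eq0 /=.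
by rewrite sqrf_eq0 gt_eqF.
Qed.

Definition node m (l : nat) : R := 2 * pi / m%:R * l%:R.

(** Orthogonality of characters of Z/m: a geometric sum whose ratio is a
    nontrivial [m]-th root of unity. *)
Lemma sum_cis_node m (a k : nat) : (a < m)%N -> (k < m)%N ->
  \sum_(l < m) cis (node m l) ^+ a * cis (- node m l) ^+ k =
  if a == k then m%:R else 0.
Proof.
move=> am km; have m0 : m%:R != 0 :> R by rewrite pnatr_eq0 -lt0n (leq_trans _ am).
have pi0 := pi_gt0 R.
pose y : R := 2 * pi / m%:R * (a%:R - k%:R).
have termE l : cis (node m l) ^+ a * cis (- node m l) ^+ k = cis y ^+ l.
  rewrite -!cis_muln -cisD; congr cis.
  rewrite -(mulr_natr _ a) -(mulr_natr _ k) -(mulr_natr y l) /y /node; ring.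
under eq_bigr do rewrite termE.
have [ak|nak] := eqVneq a k.
  rewrite /y ak subrr mulr0 cis0; under eq_bigr do rewrite expr1n.
  by rewrite sumr_const card_ord.
have ym : cis y ^+ m = 1.
  have ym' : y *+ m = 2 * pi * a%:R - 2 * pi * k%:R.
    by rewrite -mulr_natr /y; field.
  rewrite -cis_muln ym' cisD.
  have -> : cis (2 * pi * a%:R : R) = 1 by rewrite (mulr_natr (2 * pi) a) cis_muln cis2pi expr1n.
  have : cis (2 * pi * k%:R : R) = 1 by rewrite (mulr_natr (2 * pi) k) cis_muln cis2pi expr1n.
  by move=> h; rewrite mul1r -[LHS]mulr1 -h -cisD addNr cis0.
have y1 : cis y != 1.
  have mgt0 : 0 < m%:R :> R by rewrite lt_def m0 ler0n.
  have pos (b c : nat) : (b < c)%N -> (c < m)%N ->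
      0 < (2 * pi / m%:R * (c%:R - b%:R) : R) < 2 * pi.
    move=> bc cm; rewrite mulr_gt0 ?subr_gt0 ?ltr_nat// ?divr_gt0 ?mulr_gt0//=.
    rewrite -mulrA gtr_pMr ?mulr_gt0// mulrC ltr_pdivrMr// mul1r.
    rewrite -natrB; last exact: ltnW.
    by rewrite ltr_nat; exact: leq_ltn_trans (leq_subr _ _) cm.
  have [ka|ak] := ltnP k a; first exact (cis_neq1 (pos _ _ ka am)).
  have yp : 0 < - y < 2 * pi.
    have -> : - y = 2 * pi / m%:R * (k%:R - a%:R) by rewrite /y; ring.
    by apply: pos => //; rewrite ltn_neqAle nak.
  move: (cis_neq1 yp); apply: contra_neq => h; rewrite -[LHS]mul1r -h -cisD.
  by rewrite subrr cis0.
apply/eqP; have := subrX1 (cis y) m; rewrite ym subrr => /esym/eqP.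
by rewrite mulf_eq0 subr_eq0 (negPf y1).
Qed.

(** Convolution with this kernel multiplies the coefficient of degree [k] by
    [p ^+ k] if [k <= N] and kills the higher degrees: it passes to a circle [p]
    times smaller and truncates. *)
Definition trunc_kernel N p x : R[i] := \sum_(k < N.+1) (p%:C%C * cis (- x)) ^+ k.

(** For degrees below [m], averaging over the [m]-th roots of unity is as good as
    integrating over the circle. *)
Lemma trunc_kernel_node N m p (w : R[i]) a : (a < m)%N -> (N < m)%N ->
  \sum_(l < m) (w * cis (node m l)) ^+ a * trunc_kernel N p (node m l) =
  m%:R * (if (a <= N)%N then (p%:C%C * w) ^+ a else 0).
Proof.
move=> am Nm; rewrite /trunc_kernel.
under eq_bigr do rewrite mulr_sumr.
rewrite exchange_big /=.
transitivity (\sum_(k < N.+1) w ^+ a * p%:C%C ^+ k * (if a == k then m%:R else 0)).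
  apply: eq_bigr => k _; rewrite -(@sum_cis_node m a k)//; last first.
    exact: leq_trans (ltn_ord k) Nm.
  by rewrite mulr_sumr; apply: eq_bigr => l _; rewrite !exprMn; ring.
case: leqP => aN.
  rewrite (bigD1 (Ordinal (aN : (a < N.+1)%N)))//= eqxx big1 ?addr0.
    by rewrite exprMn; ring.
  move=> k /eqP ka; case: eqP => [ak|]; last by rewrite mulr0.
  by case: ka; apply: val_inj.
rewrite big1 ?mulr0// => k _; case: eqP => [ak|]; last by rewrite mulr0.
by have := ltn_ord k; rewrite -ak ltnS leqNgt aN.
Qed.

(** [sin y = 2 sin (y / 2) cos (y / 2)], with [sin (y / 2) >= (y / 2) cos (y / 2)] by
    the mean value theorem and [2 cos (y / 2) ^ 2 = 1 + cos y >= 1]. *)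
Lemma sin_ge_half (y : R) : 0 <= y <= pi / 2 -> y / 2 <= sin y.
Proof.
move=> /andP[y0 y1]; have pi0 := pi_gt0 R.
have h0 : 0 <= y / 2 by rewrite divr_ge0.
have [|c] := @MVT_segment R sin cos 0 (y / 2) h0 (fun x _ => is_derive_sin x).
  exact/continuous_subspaceT/continuous_sin.
rewrite in_itv /= sin0 !subr0 => /andP[c0 c1] sE.
have cy : cos (y / 2) <= cos c.
  have [->//|cne] := eqVneq c (y / 2).
  rewrite ltW// ltr_cos ?in_itv/=; [by rewrite lt_def eq_sym cne| |]; apply/andP; split; lra.
have cy0 : 0 <= cos (y / 2).
  by apply: cos_ge0_pihalf; apply/andP; split; lra.
have cy2 : 1 <= cos (y / 2) ^+ 2 *+ 2.
  have : 0 <= cos y by apply: cos_ge0_pihalf; apply/andP; split; lra.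
  by rewrite {1}(splitr y) -mulr2n cos_mulr2n subr_ge0.
rewrite {2}(splitr y) -mulr2n sin_mulr2n sE.
have -> : (cos (y / 2) * (cos c * (y / 2))) *+ 2 = (cos (y / 2) * cos c *+ 2) * (y / 2).
  by ring.
rewrite ler_peMl//; apply: (le_trans cy2).
by rewrite lerMn2r /= expr2 ler_wpM2l.
Qed.

(** The squared modulus is [(1 - p)^2 + 4 p sin(x/2)^2], which exceeds
    [(1 + p)^2 sin(x/2)^2] by [(1 - p)^2 cos(x/2)^2]. *)
Lemma modulus_1Bcis_ge p x : 0 <= p <= 1 ->
  `|sin (x / 2)| <= modulus (1 - p%:C%C * cis (- x)) /\
  1 - p <= modulus (1 - p%:C%C * cis (- x)).
Proof.
move=> /andP[p0 p1].
have mE : modulus (1 - p%:C%C * cis (- x)) ^+ 2 =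
    (1 - p) ^+ 2 + 4 * p * sin (x / 2) ^+ 2.
  rewrite modulus_sqrt sqr_sqrtr ?addr_ge0 ?sqr_ge0//= cosN sinN.
  have -> : sin (x / 2) ^+ 2 = (1 - cos x) / 2.
    rewrite {2}(splitr x) -mulr2n cos_mulr2n cos2sin2; by field.
  have := cos2Dsin2 x; set c := cos x; set s := sin x => cs.
  by have := congr1 (fun u => p ^+ 2 * u) cs; rewrite /= => h; lra.
split; rewrite -(@ler_pXn2r _ 2)// ?nnegrE ?modulus_ge0 ?subr_ge0// mE.
  rewrite real_normK ?num_real//; have := sin2cos2 (x / 2).
  set s := sin _; set c := cos _ => sc.
  have s1 : 0 <= 1 - s ^+ 2 by have := sqr_ge0 c; lra.
  have p2 : 0 <= (1 - p) ^+ 2 by rewrite sqr_ge0.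
  have := mulr_ge0 p2 s1; have := mulr_ge0 p0 (sqr_ge0 s); have := sqr_ge0 s; nra.
by rewrite lerDl mulr_ge0 ?sqr_ge0// mulr_ge0.
Qed.

(** Sum of the geometric progression. *)
Lemma modulus_trunc_kernel N p x : 0 <= p <= 1 ->
  modulus (1 - p%:C%C * cis (- x)) * modulus (trunc_kernel N p x) <= 2.
Proof.
move=> p01; rewrite -modulusM /trunc_kernel.
have := subrX1 (p%:C%C * cis (- x)) N.+1.
move/(congr1 -%R); rewrite opprB -mulNr opprB => <-.
rewrite (le_trans (ler_modulusD _ _))// modulus1 modulusN modulusX modulusM modulus_cis mulr1.
case/andP: p01 => p0 p1; by rewrite modulus_real// mulr2n lerD2l exprn_ile1.
Qed.

(** Comparison of [1 / (b + j)] with the integral of [1 / t] over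
    [[b + j - 1, b + j]]. *)
Lemma sum_inv_le_ln (b : R) m : 1 <= b ->
  \sum_(j < m) (b + j.+1%:R)^-1 <= ln ((b + m%:R) / b).
Proof.
move=> b1; have b0 : 0 < b by apply: lt_le_trans b1.
elim: m => [|m IH]; first by rewrite big_ord0 addr0 mulfV ?gt_eqF// ln1.
have y0 : 0 < b + m%:R by rewrite ltr_wpDr.
have y1 : 0 < b + m.+1%:R by rewrite ltr_wpDr.
rewrite big_ord_recr /=; apply: (le_trans (lerD IH (lexx _))).
have y01 : b + m.+1%:R = (b + m%:R) + 1 by rewrite -natr1 addrA.
have h : -1 < - (b + m.+1%:R)^-1.
  by rewrite ltrN2 invf_lt1// y01 ltrDr.
have := le_ln1Dx h.
have -> : 1 - (b + m.+1%:R)^-1 = ((b + m%:R) / b) / ((b + m.+1%:R) / b).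
  by rewrite y01; field; rewrite -y01 !gt_eqF.
rewrite ln_div ?posrE ?divr_gt0//; lra.
Qed.

(** The kernel is at most [2 / |1 - p cis (- x)|], that is, up to a constant,
    [1 / ((1 - q) + x)] with [x] the distance to the nearest multiple of [2 pi].
    Its mean is therefore logarithmic in [1 / (1 - q)], uniformly in the degree
    [N] and in the number [m] of nodes, as soon as the mesh [1 / m] is at most [1 - q]. *)
Lemma sum_modulus_trunc_kernel N m p q : (0 < m)%N -> 0 <= p <= q -> q < 1 ->
  1 <= m%:R * (1 - q) ->
  \sum_(l < m) modulus (trunc_kernel N p (node m l)) <=
    m%:R * (8 * (1 + ln (1 + (1 - q)^-1))).
Proof.
move=> m0 /andP[p0 pq] q1 mq; set b := m%:R * (1 - q).
have pi0 := pi_gt0 R.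
have b0 : 0 < b by apply: lt_le_trans mq.
have mR : 0 < m%:R :> R by rewrite ltr0n.
have p01 : 0 <= p <= 1 by rewrite p0 (le_trans pq)// ltW.
have ptw (l : 'I_m) : modulus (trunc_kernel N p (node m l)) <=
    m%:R * (4 * ((b + l%:R)^-1 + (b + (m - l)%:R)^-1)).
  have [h1 h2] := modulus_1Bcis_ge (node m l) p01.
  have h3 := modulus_trunc_kernel N (node m l) p01.
  set M := modulus (1 - _) in h1 h2 h3.
  have lm := ltn_ord l.
  have {}h2 : 1 - q <= M by apply: le_trans h2; rewrite lerD2l lerN2.
  have key (j : nat) : (j <= m)%N -> j%:R / m%:R <= `|sin (node m l / 2)| ->
      modulus (trunc_kernel N p (node m l)) <= m%:R * (4 * (b + j%:R)^-1).
    move=> jm hj; have {}hj : j%:R / m%:R <= M by apply: le_trans h1.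
    have M0 : (b + j%:R) / m%:R <= 2 * M.
      by rewrite mulrDl {1}/b mulrAC mulfV ?gt_eqF// mul1r mulr2n mulrDl mul1r lerD.
    have bj : 0 < b + j%:R by rewrite ltr_wpDr.
    have -> : m%:R * (4 * (b + j%:R)^-1) = 4 / ((b + j%:R) / m%:R).
      by field; rewrite !gt_eqF.
    rewrite ler_pdivlMr ?divr_gt0//.
    apply: (@le_trans _ _ (modulus (trunc_kernel N p (node m l)) * (2 * M))).
      by rewrite ler_wpM2l ?modulus_ge0.
    by rewrite mulrCA mulrC -(mulrC M); lra.
  have lmR : l%:R <= m%:R :> R by rewrite ler_nat ltnW.
  have nE : node m l / 2 = pi * (l%:R / m%:R) by rewrite /node; field; rewrite gt_eqF.
  have t0 : 0 <= l%:R / m%:R :> R by rewrite divr_ge0.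
  have t1 : l%:R / m%:R <= 1 :> R by rewrite ler_pdivrMr// mul1r.
  have pi2 := pi_ge2 R.
  have [half|half] := leP (l%:R / m%:R : R) (1 / 2).
    apply: le_trans (key l (ltnW lm) _) _.
      apply: le_trans (ler_norm _); apply: le_trans (sin_ge_half _); rewrite nE.
        by nra.
      by apply/andP; split; nra.
    by rewrite ler_wpM2l// ler_wpM2l// lerDl invr_ge0 addr_ge0// ltW.
  apply: le_trans (key (m - l)%N (leq_subr _ _) _) _.
    have -> : node m l / 2 = pi - pi * (1 - l%:R / m%:R) by rewrite nE; ring.
    rewrite sinB sinpi cospi mul0r sub0r mulN1r opprK.
    have mlE : (m - l)%:R / m%:R = 1 - l%:R / m%:R :> R.
      by rewrite natrB 1?ltnW// mulrBl mulfV ?gt_eqF.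
    rewrite mlE; apply: le_trans (ler_norm _); apply: le_trans (sin_ge_half _).
      by nra.
    by apply/andP; split; nra.
  by rewrite ler_wpM2l// ler_wpM2l// lerDr invr_ge0 addr_ge0// ltW.
apply: le_trans (ler_sum _ (fun l _ => ptw l)) _.
rewrite -mulr_sumr ler_wpM2l// -mulr_sumr big_split /=.
set S := \sum_(j < m) (b + j.+1%:R)^-1.
have S1 : \sum_(i < m) (b + i%:R)^-1 <= 1 + S.
  rewrite /S; move: m0 mq; rewrite -/b; case: (m) => // k _ b1.
  rewrite big_ord_recl big_ord_recr /= addr0 lerD ?invf_le1//.
  by rewrite lerDl invr_ge0 addr_ge0// ltW.
have S2 : \sum_(i < m) (b + (m - i)%:R)^-1 = S.
  rewrite (reindex_inj rev_ord_inj) /=; apply: eq_bigr => i _.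
  by rewrite subKn.
have SL : S <= ln (1 + (1 - q)^-1).
  apply: le_trans (sum_inv_le_ln _ mq) _; rewrite le_eqVlt; apply/orP; left.
  apply/eqP; congr ln; rewrite /b; field; rewrite !gt_eqF//.
  by rewrite subr_gt0.
have L0 : 0 <= ln (1 + (1 - q)^-1).
  by rewrite ln_ge0// lerDl invr_ge0 subr_ge0 ltW.
rewrite S2; lra.
Qed.

End Kernel.

(** * Square partial sums and discrete averages *)

Section MultiIndex.
Context (R : realType) (n : nat).
Implicit Types (al : multi_index n) (N : nat) (a : multi_index n -> R[i]).

Lemma mi_normP al N : reflect (forall j, (al j <= N)%N) (mi_norm al <= N)%N.
Proof.
by apply: (iffP (bigmax_leqP _ _ _)) => [H j|H j _]; [exact: H|exact: H].
Qed.

Definition box N : {fset multi_index n} :=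
  fset_set [set al : multi_index n | (mi_norm al <= N)%N].

Lemma finite_box N : finite_set [set al : multi_index n | (mi_norm al <= N)%N].
Proof.
apply: (@sub_finite_set _ _ [set [ffun j => (l j : nat)] | l in
  [set: {ffun 'I_n -> 'I_N.+1}]]); last exact: finite_image.
move=> al /= /mi_normP alN; exists [ffun j => inord (al j)] => //.
by apply/ffunP => j; rewrite !ffunE inordK// ltnS.
Qed.

Lemma mem_box N al : (al \in box N) = (mi_norm al <= N)%N.
Proof.
by rewrite /box in_fset_set ?inE//; [apply/idP/idP; rewrite inE|exact: finite_box].
Qed.

Lemma square_partial_sumE a N (z : cvec R n) :
  square_partial_sum a N z = \sum_(al <- box N) a al * monomial al z.
Proof. by rewrite /square_partial_sum fsbig_finite//; exact: finite_box. Qed.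

Lemma square_partial_sum_filter a N (A : {fset multi_index n}) (z : cvec R n) :
  (box N `<=` A)%fset ->
  square_partial_sum a N z =
    \sum_(al <- A | (mi_norm al <= N)%N) a al * monomial al z.
Proof.
move=> NA; rewrite square_partial_sumE -[RHS]big_filter; apply: perm_big.
apply: uniq_perm; [exact: fset_uniq|exact/filter_uniq/fset_uniq|move=> al].
rewrite mem_filter mem_box; case: (boolP (mi_norm al <= N)%N) => //= alN.
by apply/esym/(fsubsetP NA); rewrite mem_box.
Qed.

(** Product over the variables of the one-variable formula [trunc_kernel_node]. *)
Lemma average_polynomial a (A : seq (multi_index n)) N m (p : 'I_n -> R)
    (w : 'I_n -> R[i]) :
  (N < m)%N -> (forall al, al \in A -> forall j, (al j < m)%N) ->
  \sum_(l : {ffun 'I_n -> 'I_m})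
    (\sum_(al <- A) a al * \prod_j (w j * cis (node R m (l j))) ^+ al j) *
    (\prod_j trunc_kernel N (p j) (node R m (l j))) =
  m%:R ^+ n *
    \sum_(al <- A | (mi_norm al <= N)%N) a al * \prod_j ((p j)%:C%C * w j) ^+ al j.
Proof.
move=> Nm Am; under eq_bigr do rewrite mulr_suml.
rewrite exchange_big mulr_sumr /= [RHS]big_mkcond /= big_seq [RHS]big_seq.
apply: eq_bigr => al alA.
under eq_bigr do rewrite -mulrA -big_split /=.
rewrite -mulr_sumr.
pose F (j : 'I_n) (i : 'I_m) := (w j * cis (node R m i)) ^+ al j *
  trunc_kernel N (p j) (node R m i).
rewrite -(bigA_distr_bigA F) /F.
transitivity (a al * \prod_j (m%:R * (if (al j <= N)%N then
    ((p j)%:C%C * w j) ^+ al j else 0))).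
  by congr (_ * _); apply: eq_bigr => j _; rewrite trunc_kernel_node// Am.
case: ifPn => [/mi_normP alN|].
  rewrite big_split /= prodr_const card_ord mulrCA; congr (_ * (_ * _)).
  by apply: eq_bigr => j _; rewrite alN.
move=> nal; have [j jN] : exists j, ~~ (al j <= N)%N.
  by apply/existsP; rewrite -negb_forall; apply: contra nal => /forallP/mi_normP.
by rewrite (bigD1 j)//= (negPf jN) mulr0 mul0r mulr0.
Qed.

End MultiIndex.

(** * Reproducing a partial sum from a larger torus *)

Section Expansion.
Context (R : realType) (n : nat) (D : set (cvec R n)) (f : cvec R n -> R[i]^o).
Context (a : multi_index n -> R[i]).
Hypothesis ha : power_series_expansion D f a.

(** Angles can be reduced modulo [2 * pi]; this makes the torus compact. *)
Lemma torus_range (r : n.-tuple R) : polar r @` @cube R n = range (polar r).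
Proof.
apply/seteqP; split => _ [th _ <-]; first by exists th.
have /choice[x xP] : forall j, exists x, 0 <= x < 2 * pi /\
    cis (tnth th j) = cis x.
  by move=> j; have [x ? ?] := cis_surj (modulus_cis (tnth th j)); exists x.
exists [tuple x j | j < n].
  move=> j; rewrite tnth_mktuple in_itv /=; have [/andP[-> /ltW ->]] := xP j.
  by [].
by apply/rowP => j; rewrite !mxE tnth_mktuple; congr (_ * _); exact/esym/(proj2 (xP j)).
Qed.

Lemma expansion_on_torus (r : n.-tuple R) (e : R) : range (polar r) `<=` D -> 0 < e ->
  exists A0 : {fset multi_index n}, forall A, (A0 `<=` A)%fset ->
    forall th, modulus (\sum_(al <- A) a al * monomial al (polar r th) -
                        f (polar r th)) < e.
Proof.
move=> rD e0; have cr : compact (range (polar r)) by rewrite -torus_range; exact: torus_compact.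
have [A0 A0P] := ha cr rD e0; exists A0 => A AA th.
by rewrite -modulus_lt; apply: A0P => //; exists th.
Qed.

Lemma partial_sums_cvg_on_compact (K : set (cvec R n)) (e : R) :
  compact K -> K `<=` D -> 0 < e ->
  exists N0, forall N, (N0 <= N)%N -> forall z, K z ->
    modulus (square_partial_sum a N z - f z) < e.
Proof.
move=> cK KD e0; have [A0 A0P] := ha cK KD e0.
exists (\max_(al <- A0) mi_norm al)%N => N NN z Kz.
rewrite square_partial_sumE -modulus_lt; apply: A0P => //.
apply/fsubsetP => al alA; rewrite mem_box; apply: leq_trans NN.
exact: (leq_bigmax_seq al).
Qed.

Lemma partial_sums_cvg_on_torus (r : n.-tuple R) (e : R) :
  range (polar r) `<=` D -> 0 < e ->
  exists N0, forall N, (N0 <= N)%N -> forall th,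
    modulus (square_partial_sum a N (polar r th) - f (polar r th)) < e.
Proof.
move=> rD e0.
have cr : compact (range (polar r)) by rewrite -torus_range; exact: torus_compact.
have [N0 N0P] := partial_sums_cvg_on_compact cr rD e0.
by exists N0 => N NN th; apply: N0P => //; exists th.
Qed.

(** Bound for the mean of the modulus of the kernel at radius ratio at most [q].
    As for the Lebesgue constants of Fourier series, the growth is logarithmic,
    here in [1 / (1 - q)] instead of the degree. *)
Definition lebesgue_constant (q : R) := 8 * (1 + ln (1 + (1 - q)^-1)).

Lemma lebesgue_constant_ge0 q : q < 1 -> 0 <= lebesgue_constant q.
Proof.
move=> q1; rewrite mulr_ge0// addr_ge0// ln_ge0// lerDl invr_ge0 subr_ge0.
exact: ltW.
Qed.

(** On the torus of radius [r], [f] is within [e] of a polynomial [F] with the same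
    square partial sum.  Averaging [F] against the kernels over sufficiently many
    roots of unity gives this partial sum exactly on the smaller torus; the weights
    [c] are the normalised moduli of the kernels. *)
Lemma partial_sum_le_average (r : n.-tuple R) (q : R) (p : 'I_n -> R) N (e : R) :
  range (polar r) `<=` D -> q < 1 -> (forall j, 0 <= p j <= q) -> 0 < e ->
  exists m (c : {ffun 'I_n -> 'I_m} -> R),
    [/\ forall l, 0 <= c l, \sum_l c l <= lebesgue_constant q ^+ n &
     forall u : n.-tuple R,
      modulus (square_partial_sum a N (\row_j ((p j * tnth r j)%:C%C * cis (tnth u j))))
      <= \sum_l c l * (modulus (f (polar r
           [tuple tnth u j + node R m (l j) | j < n])) + e)].
Proof.
move=> rD q1 pq e0; have [A0 A0P] := expansion_on_torus rD e0.
pose A := (A0 `|` box n N)%fset.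
(* enough nodes to see all degrees of [F] and [N], and a mesh finer than [1 - q] *)
pose m := (N.+1 + (\max_(al <- A) mi_norm al).+1 + (Num.truncn (1 - q)^-1).+1)%N.
exists m, (fun l : {ffun 'I_n -> 'I_m} => (m%:R ^+ n)^-1 *
   \prod_j modulus (trunc_kernel N (p j) (node R m (l j)))).
have Nm : (N < m)%N by rewrite /m -addnA leq_addr.
have m0 : (0 < m)%N by apply: leq_ltn_trans Nm.
have mR : 0 < m%:R :> R by rewrite ltr0n.
have mn0 : m%:R ^+ n != 0 :> R by rewrite expf_neq0// gt_eqF.
have Am al : al \in A -> forall j, (al j < m)%N.
  move=> alA j; have h : (al j <= mi_norm al)%N by exact/mi_normP.
  apply: (leq_ltn_trans h); apply: (@leq_ltn_trans (\max_(al <- A) mi_norm al)%N).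
    exact: (leq_bigmax_seq al).
  by rewrite /m addnAC addnC; exact: leq_addr.
have mq : 1 <= m%:R * (1 - q).
  rewrite -ler_pdivrMr ?subr_gt0// mul1r; apply: ltW.
  apply: (lt_le_trans (truncnS_gt _)).
  by rewrite ler_nat /m addnC leq_addr.
split.
- move=> l; rewrite mulr_ge0 ?invr_ge0 ?exprn_ge0//.
  by rewrite prodr_ge0// => j _; exact: modulus_ge0.
- pose F j (i : 'I_m) := modulus (trunc_kernel N (p j) (node R m i)).
  rewrite -mulr_sumr -(bigA_distr_bigA F) ler_pdivrMl ?exprn_gt0//.
  rewrite -exprMn -[X in _ ^+ X]card_ord -prodr_const; apply: ler_prod => j _.
  rewrite sumr_ge0 => [|i _]; last exact: modulus_ge0.
  by rewrite /F sum_modulus_trunc_kernel.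
move=> u.
pose w j : R[i] := (tnth r j)%:C%C * cis (tnth u j).
pose th (l : {ffun 'I_n -> 'I_m}) := [tuple tnth u j + node R m (l j) | j < n].
pose F l := \sum_(al <- A) a al * monomial al (polar r (th l)).
have FE l : F l = \sum_(al <- A) a al * \prod_j (w j * cis (node R m (l j))) ^+ al j.
  apply: eq_bigr => al _; congr (_ * _); apply: eq_bigr => j _.
  by rewrite mxE tnth_mktuple -[(_ +i* _)%C]/(cis _) cisD mulrA.
set z := \row__ _.
have SE : square_partial_sum a N z = (m%:R ^+ n)^-1 *
    \sum_l F l * \prod_j trunc_kernel N (p j) (node R m (l j)).
  have NA : (box n N `<=` A)%fset by exact: fsubsetUr.
  under eq_bigr do rewrite FE.
  rewrite (average_polynomial a p w Nm Am) mulKf; last first.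
    by rewrite expf_neq0// pnatr_eq0 -lt0n.
  rewrite (square_partial_sum_filter _ _ NA); apply: eq_bigr => al _.
  congr (_ * _); apply: eq_bigr => j _; congr (_ ^+ _).
  by rewrite mxE /w mulrA -rmorphM.
rewrite SE modulusM modulusV modulusX.
have -> : modulus m%:R = m%:R :> R.
  by rewrite -(rmorph_nat (real_complex R)) modulus_real.
under [leRHS]eq_bigr do rewrite -mulrA.
rewrite -mulr_sumr ler_wpM2l ?invr_ge0 ?exprn_ge0//.
apply: le_trans (ler_modulus_sum _ _ _) _; apply: ler_sum => l _.
rewrite modulusM modulus_prod mulrC ler_wpM2l//.
  by rewrite prodr_ge0// => j _; exact: modulus_ge0.
have Fl : modulus (F l - f (polar r (th l))) < e by apply: A0P; exact: fsubsetUl.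
have := ler_modulusD (f (polar r (th l))) (F l - f (polar r (th l))).
rewrite addrC subrK => h; apply: (le_trans h); rewrite lerD2l; exact: ltW.
Qed.

End Expansion.

(** * Measurability of the partial sums and of their limit *)

Section Measurability.
Context (R : realType) (n : nat) d (T : measurableType d).

Definition cmeasurable (D : set T) (h : T -> R[i]) :=
  measurable_fun D (fun t => complex.Re (h t)) /\
  measurable_fun D (fun t => complex.Im (h t)).

Lemma cmeasurable_cst D c : cmeasurable D (fun=> c).
Proof. by split; exact: measurable_cst. Qed.

Lemma cmeasurableD D h1 h2 : cmeasurable D h1 -> cmeasurable D h2 ->
  cmeasurable D (fun t => h1 t + h2 t).
Proof.
move=> [m1 m2] [m3 m4]; split.
  under eq_fun do rewrite raddfD /=.
  exact: measurable_funD.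
under eq_fun do rewrite raddfD /=.
exact: measurable_funD.
Qed.

Lemma cmeasurableM D h1 h2 : cmeasurable D h1 -> cmeasurable D h2 ->
  cmeasurable D (fun t => h1 t * h2 t).
Proof.
have ReM (x y : R[i]) : complex.Re (x * y) =
    complex.Re x * complex.Re y - complex.Im x * complex.Im y.
  by case: x y => ? ? [].
have ImM (x y : R[i]) : complex.Im (x * y) =
    complex.Re x * complex.Im y + complex.Im x * complex.Re y.
  by case: x y => ? ? [].
move=> [m1 m2] [m3 m4]; split.
  under eq_fun do rewrite ReM.
  by apply: measurable_funB; apply: measurable_funM.
under eq_fun do rewrite ImM.
by apply: measurable_funD; apply: measurable_funM.
Qed.

Lemma measurable_modulus D h : cmeasurable D h ->
  measurable_fun D (fun t => modulus (h t)).
Proof.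
move=> [m1 m2]; under eq_fun do rewrite modulus_sqrt.
apply: (@measurableT_comp _ _ _ _ _ _ (@Num.sqrt R)).
  by apply: continuous_measurable_fun; exact: sqrt_continuous.
by apply: measurable_funD; exact: measurable_funX.
Qed.

Lemma cmeasurable_square_partial_sum D (a : multi_index n -> R[i]) N
    (g : T -> cvec R n) :
  (forall j, cmeasurable D (fun t => g t ord0 j)) ->
  cmeasurable D (fun t => square_partial_sum a N (g t)).
Proof.
move=> mg; under eq_fun do rewrite square_partial_sumE.
elim: (finmap.enum_fset _) => [|al s IH].
  by under eq_fun do rewrite big_nil; exact: cmeasurable_cst.
under eq_fun do rewrite big_cons.
apply: cmeasurableD => //; apply: cmeasurableM; first exact: cmeasurable_cst.
rewrite /monomial; elim: (index_enum _) => [|j r IHr].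
  by under eq_fun do rewrite big_nil; exact: cmeasurable_cst.
under eq_fun do rewrite big_cons.
apply: cmeasurableM => //; elim: (al j) => [|k IHk].
  by under eq_fun do rewrite expr0; exact: cmeasurable_cst.
by under eq_fun do rewrite exprS; exact: cmeasurableM.
Qed.

Context (D : set (cvec R n)) (f : cvec R n -> R[i]^o).
Context (a : multi_index n -> R[i]).
Hypothesis ha : power_series_expansion D f a.

Lemma partial_sums_cvg z : D z -> forall e : R, 0 < e -> exists N0, forall N,
  (N0 <= N)%N -> modulus (square_partial_sum a N z - f z) < e.
Proof.
move=> Dz e e0.
have [||N0 N0P] := partial_sums_cvg_on_compact (K := [set z]) ha _ _ e0.
- exact: compact_set1.
- by move=> _ ->.
- by exists N0 => N NN; exact: N0P.
Qed.

(** [f] is the pointwise limit of its square partial sums, which are polynomials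
    in the coordinates. *)
Lemma measurable_modulus_sub (g : T -> cvec R n) (h : T -> R[i]) :
  coord_measurable g -> cmeasurable (g @^-1` D) h ->
  measurable_fun (g @^-1` D) (fun t => modulus (h t - f (g t))).
Proof.
move=> mg mh.
apply: (measurable_fun_cvg (h := fun N t =>
  modulus (h t - square_partial_sum a N (g t)))) => [N|t Dt].
  apply: measurable_modulus; apply: cmeasurableD => //.
  have -> : (fun t => - square_partial_sum a N (g t)) =
    (fun t => (-1) * square_partial_sum a N (g t)).
    by apply/funext => t; rewrite mulN1r.
  apply: cmeasurableM; first exact: cmeasurable_cst.
  apply: cmeasurable_square_partial_sum => j; have [m1 m2] := mg j.
  by split; [exact: measurable_funS m1|exact: measurable_funS m2].
apply/cvgrPdist_lt => e e0.
have [N0 N0P] := partial_sums_cvg Dt e0.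
exists N0 => // N /= NN; apply: le_lt_trans (N0P _ NN).
have dist (x y : R[i]) : `|modulus x - modulus y| <= modulus (x - y).
  have := ler_modulusD (x - y) y; have := ler_modulusD (y - x) x.
  rewrite !subrK (modulusB y) ler_norml => h1 h2.
  by apply/andP; split; lra.
apply: le_trans (dist _ _) _; rewrite le_eqVlt; apply/orP; left; apply/eqP.
by congr modulus; ring.
Qed.

Lemma measurable_modulus_comp (g : T -> cvec R n) :
  coord_measurable g -> measurable_fun (g @^-1` D) (fun t => modulus (f (g t))).
Proof.
move=> mg; have m0 : cmeasurable (g @^-1` D) (fun=> 0 : R[i]).
  exact: cmeasurable_cst.
have := measurable_modulus_sub mg m0.
by under eq_fun do rewrite sub0r modulusN.
Qed.

Lemma measurable_partial_sum_error (g : T -> cvec R n) N :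
  coord_measurable g ->
  measurable_fun (g @^-1` D) (fun t => modulus (square_partial_sum a N (g t) - f (g t))).
Proof.
move=> mg; apply: measurable_modulus_sub => //.
apply: cmeasurable_square_partial_sum => j; have [m1 m2] := mg j.
by split; [exact: measurable_funS m1|exact: measurable_funS m2].
Qed.

End Measurability.

(** * Invariance of torus means *)

Section Torus.
Context (R : realType) (n : nat).
Local Notation angle := (power_measure (@lebesgue_measure R) n).
Local Notation TR := (measurableTypeR R).
Local Open Scope ereal_scope.

Lemma measurable_cube : measurable (@cube R n : set (n.-tuple TR)).
Proof.
rewrite (_ : @cube R n = \bigcap_(j in [set: 'I_n])
    ((@tnth n TR)^~ j @^-1` `[0%R, (2 * pi)%R]%classic)).
  apply: fin_bigcap_measurable => // j _.
  by rewrite -[X in measurable X]setTI; apply: measurable_tnth => //; exact: measurable_itv.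
by apply/seteqP; split => [th H j _|th H j]; [exact: H|exact: H].
Qed.

Lemma cube_volume : angle (@cube R n) = ((2 * pi) ^+ n)%R%:E.
Proof.
have pi0 : (0 < 2 * pi :> R)%R by rewrite mulr_gt0// pi_gt0.
have := @power_measureE _ _ R (@lebesgue_measure R) n (fun=> `[0%R, (2 * pi)%R]%classic).
rewrite (_ : [set t | _] = @cube R n)// => ->; last by move=> _; exact: measurable_itv.
rewrite (eq_bigr (fun=> (2 * pi)%R%:E)) => [|i _]; last first.
  by have := @lebesgue_measure_itv R `[0%R, (2 * pi)%R]; rewrite /= lte_fin pi0 -EFinD subr0.
by rewrite prodEFin prodr_const card_ord.
Qed.

Lemma cmeasurable_cis d (T : measurableType d) (D : set T) (h : T -> R) :
  measurable_fun D h -> cmeasurable D (fun t => cis (h t)).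
Proof.
move=> mh; split; apply: measurableT_comp mh; apply: continuous_measurable_fun.
  exact: continuous_cos.
exact: continuous_sin.
Qed.

Lemma coord_measurable_polar (r : n.-tuple R) :
  coord_measurable (fun th : n.-tuple TR => polar r th).
Proof.
move=> j; have : cmeasurable setT (fun th : n.-tuple TR => (tnth r j)%:C%C * cis (tnth th j))%R.
  apply: cmeasurableM; first exact: cmeasurable_cst.
  by apply: cmeasurable_cis; exact: measurable_tnth.
by move=> [m1 m2]; split; [apply: eq_measurable_fun m1|apply: eq_measurable_fun m2] => th _;
  rewrite mxE.
Qed.

Lemma polar_turn (r x th : n.-tuple R) : (forall j, 0 <= tnth x j < 2 * pi)%R ->
  @cube R n th ->
  polar r (tuple_map (fun j => turn (tnth x j)) th) =
  polar r [tuple tnth th j + tnth x j | j < n]%R.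
Proof.
move=> x02 cth; apply/rowP => j; rewrite !mxE !tnth_mktuple.
rewrite -![(cos _ +i* sin _)%C]/(cis _); congr (_ * _)%R.
have := cth j; rewrite in_itv /= => t02; rewrite /turn t02; case: ifP => // _.
by rewrite -[LHS]mul1r -cis2pi -cisD; congr cis; ring.
Qed.

Lemma preimage_cube_turn (x : n.-tuple R) : (forall j, 0 <= tnth x j < 2 * pi)%R ->
  tuple_map (fun j => turn (tnth x j)) @^-1` @cube R n = @cube R n.
Proof.
move=> x02; have tP (b t : R) : (0 <= b < 2 * pi)%R ->
    (turn b t \in `[0, 2 * pi]%R) = (t \in `[0, 2 * pi]%R).
  move=> /andP[b0 b1]; rewrite /turn !in_itv /=.
  case: ifPn => [/andP[t0 t1]|/negPf ->//].
  case: ifPn => [h|]; first by apply/andP; split; lra.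
  by rewrite -ltNge => h; apply/andP; split; lra.
by apply/seteqP; split => th /= H j; have := H j; rewrite tnth_mktuple tP.
Qed.

(** Up to a multiple of [2 * pi] in each angle, the shift is a [turn]. *)
Lemma integral_cube_shift (r u : n.-tuple R) (h : cvec R n -> \bar R) :
  (forall z, 0 <= h z) ->
  measurable_fun setT (fun th : n.-tuple TR => h (polar r th)) ->
  \int[angle]_(th in @cube R n) h (polar r [tuple tnth th j + tnth u j | j < n]%R) =
  \int[angle]_(th in @cube R n) h (polar r th).
Proof.
move=> h0 mh.
have /choice[x xP] : forall j, exists x, (0 <= x < 2 * pi)%R /\ cis (tnth u j) = cis x.
  by move=> j; have [x ? ?] := cis_surj (modulus_cis (tnth u j)); exists x.
pose X := [tuple x j | j < n].
have X02 j : (0 <= tnth X j < 2 * pi)%R by rewrite tnth_mktuple; exact: (xP j).1.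
pose phi := tuple_map (fun j => turn (tnth X j)).
have shiftE th : @cube R n th ->
    polar r [tuple tnth th j + tnth u j | j < n]%R = polar r (phi th).
  move=> cth; rewrite polar_turn//; apply/rowP => j; rewrite !mxE !tnth_mktuple.
  rewrite -![(cos _ +i* sin _)%C]/(cis _); congr (_ * _)%R.
  by rewrite !cisD (xP j).2.
have mphi : measurable_fun setT phi.
  by apply: measurable_tuple_map => j; exact: measurable_turn.
pose g := (fun th : n.-tuple TR => h (polar r th)) \_ (@cube R n).
have mg : measurable_fun setT g.
  apply/(measurable_restrictT _ measurable_cube); exact: measurable_funS mh.
have g0 th : 0 <= g th by rewrite /g /patch; case: ifP.
transitivity (\int[angle]_th g (phi th)).
  rewrite integral_mkcond; apply: eq_integral => th _; rewrite /g /patch.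
  have -> : (phi th \in @cube R n) = (th \in @cube R n).
    by rewrite -[in RHS](preimage_cube_turn X02); apply/idP/idP; rewrite !inE.
  by case: ifP => // /set_mem /shiftE ->.
rewrite (@ge0_integral_scales_measure _ _ _ angle (1%:nng)%R phi g)//.
  by rewrite mul1e [RHS]integral_mkcond.
have := @power_measure_scales _ TR R (@lebesgue_measure R) (1%:nng)%R n
  (fun j => turn (tnth X j)).
rewrite /= expr1n; apply => j; [exact: measurable_turn|exact: turn_preserves].
Qed.

End Torus.

(** * Torus means of square partial sums *)

Section TorusMeans.
Context (R : realType) (n : nat) (D : set (cvec R n)) (f : cvec R n -> R[i]^o).
Context (a : multi_index n -> R[i]).
Hypothesis ha : power_series_expansion D f a.
Hypothesis hfin : (Hardy1_norm D f < +oo)%E.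
Local Notation angle := (power_measure (@lebesgue_measure R) n).
Local Notation TR := (measurableTypeR R).
Local Notation mean g := (\int[angle]_(th in @cube R n) g th)%E.

Definition rotate (th : n.-tuple R) (z : cvec R n) : cvec R n :=
  \row_j (cis (tnth th j) * z ord0 j).

Lemma coord_measurable_comp d d' (T : measurableType d) (T' : measurableType d')
    (g : T' -> cvec R n) (phi : T -> T') :
  coord_measurable g -> measurable_fun setT phi -> coord_measurable (g \o phi).
Proof.
by move=> mg mphi j; have [m1 m2] := mg j; split;
  [exact: (measurableT_comp m1 mphi)|exact: (measurableT_comp m2 mphi)].
Qed.

Lemma coord_measurable_rotate (z : cvec R n) :
  coord_measurable (fun th : n.-tuple TR => rotate th z).
Proof.
move=> j; have : cmeasurable setT (fun th : n.-tuple TR => cis (tnth th j) * z ord0 j).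
  apply: cmeasurableM; last exact: cmeasurable_cst.
  by apply: cmeasurable_cis; exact: measurable_tnth.
by move=> [m1 m2]; split; [apply: eq_measurable_fun m1|apply: eq_measurable_fun m2] => th _;
  rewrite mxE.
Qed.

Lemma measurable_polar_shift r (v : n.-tuple R) : range (polar r) `<=` D ->
  measurable_fun setT (fun th : n.-tuple TR =>
    modulus (f (polar r [tuple tnth th j + tnth v j | j < n]))).
Proof.
move=> rD.
have mphi : measurable_fun setT (fun th : n.-tuple TR =>
    [tuple tnth th j + tnth v j | j < n] : n.-tuple TR).
  apply/measurable_fun_tnthP => j.
  rewrite (_ : _ \o _ = fun th : n.-tuple TR => tnth th j + tnth v j); last first.
    by apply/funext => th /=; rewrite tnth_mktuple.
  by apply: measurable_funD => //; exact: measurable_tnth.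
have := measurable_modulus_comp ha (coord_measurable_comp (coord_measurable_polar r) mphi).
rewrite (_ : _ @^-1` D = setT)//; apply/seteqP; split => // th _ /=.
by apply: rD; eexists.
Qed.

Lemma measurable_polar r : range (polar r) `<=` D ->
  measurable_fun setT (fun th : n.-tuple TR => modulus (f (polar r th))).
Proof.
move=> rD; have := measurable_modulus_comp ha (coord_measurable_polar r).
rewrite (_ : _ @^-1` D = setT)//; apply/seteqP; split => // th _ /=.
by apply: rD; exists th.
Qed.

Lemma mean_le_Hardy1 r : admissible_radii D r ->
  (mean (fun th => (modulus (f (polar r th)))%:E) <= Hardy1_norm D f)%E.
Proof. by move=> rD; apply: ereal_sup_ubound; exists r. Qed.

Lemma Hardy1_norm_fin r : admissible_radii D r -> Hardy1_norm D f \is a fin_num.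
Proof.
move=> rD; rewrite ge0_fin_numE//; apply: le_trans (mean_le_Hardy1 rD).
by apply: integral_ge0 => th _; rewrite lee_fin modulus_ge0.
Qed.

Lemma measurable_partial_sum_rotate N (z : cvec R n) :
  measurable_fun setT (fun th : n.-tuple TR =>
    modulus (square_partial_sum a N (rotate th z))).
Proof.
apply: measurable_modulus; apply: cmeasurable_square_partial_sum => j.
by have [] := coord_measurable_rotate z j.
Qed.

Lemma mean_cst e : mean (fun=> e%:E) = (e * (2 * pi) ^+ n)%:E.
Proof.
rewrite integral_cst; last exact: measurable_cube.
by rewrite EFinM; congr (_ * _)%E; exact: cube_volume.
Qed.

(** Integrating [partial_sum_le_average] over the torus turns every translate of
    [f] into the same mean, which the Hardy norm bounds; the weights sum to at most
    the [n]-th power of the constant of one variable. *)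
Lemma mean_partial_sum_le r (q : R) (z : cvec R n) N : admissible_radii D r -> 0 <= q < 1 ->
  (forall j, modulus (z ord0 j) <= q * tnth r j) ->
  (mean (fun th => (modulus (square_partial_sum a N (rotate th z)))%:E) <=
   (lebesgue_constant q ^+ n)%:E * Hardy1_norm D f)%E.
Proof.
move=> rA /andP[q0 q1] zq; have [r0 rD] := rA.
have Mfin := Hardy1_norm_fin rA.
have k0 := lebesgue_constant_ge0 q1.
set k := lebesgue_constant q in k0 *.
have tp0 : 0 <= (2 * pi) ^+ n :> R by rewrite exprn_ge0// mulr_ge0// pi_ge0.
have /choice[psi psiP] : forall j, exists x, z ord0 j = (modulus (z ord0 j))%:C%C * cis x.
  by move=> j; have [x _ xE] := polar_form (z ord0 j); exists x.
pose p j := modulus (z ord0 j) / tnth r j.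
have pq j : 0 <= p j <= q.
  by rewrite /p divr_ge0 ?modulus_ge0 ?(ltW (r0 j))//= ler_pdivrMr// zq.
apply/lee_addgt0Pr => d d0.
(* [e] is integrated over the cube and summed against the weights *)
pose e := d / (k ^+ n * (2 * pi) ^+ n + 1).
have den0 : 0 < k ^+ n * (2 * pi) ^+ n + 1.
  by rewrite ltr_wpDl// mulr_ge0// exprn_ge0.
have e0 : 0 < e by rewrite divr_gt0.
have [m [c [c0 ck cS]]] := partial_sum_le_average ha N rD q1 pq e0.
pose v (l : {ffun 'I_n -> 'I_m}) := [tuple psi j + node R m (l j) | j < n].
have mcube := @measurable_cube R n.
have mshift l : measurable_fun (@cube R n : set (n.-tuple TR)) (fun th : n.-tuple TR =>
    modulus (f (polar r [tuple tnth th j + tnth (v l) j | j < n]))).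
  by apply: measurable_funS (measurable_polar_shift (v l) rD).
pose F l th := (c l * (modulus (f (polar r [tuple tnth th j + tnth (v l) j | j < n])) + e)).
have mF l : measurable_fun (@cube R n : set (n.-tuple TR)) (fun th : n.-tuple TR => F l th).
  by apply: measurable_funM => //; apply: measurable_funD.
have F0 l th : 0 <= F l th by rewrite mulr_ge0// addr_ge0 ?modulus_ge0// ltW.
apply: (@le_trans _ _ (mean (fun th => \sum_l (F l th)%:E)%E)).
  apply: ge0_le_integral => //.
  - by move=> th _; rewrite lee_fin modulus_ge0.
  - apply/measurable_EFinP; apply: measurable_funS (measurable_partial_sum_rotate N z) => //.
  - by apply: emeasurable_sum => l; apply/measurable_EFinP.
  move=> th _; rewrite sumEFin lee_fin.
  have := cS [tuple tnth th j + psi j | j < n].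
  have -> : \row_j ((p j * tnth r j)%:C%C *
      cis (tnth [tuple tnth th j0 + psi j0 | j0 < n] j)) = rotate th z.
    apply/rowP => j; rewrite !mxE tnth_mktuple /p mulfVK ?gt_eqF//.
    by rewrite [in RHS]psiP cisD; ring.
  move=> h; apply: (le_trans h); rewrite le_eqVlt; apply/orP; left; apply/eqP.
  apply: eq_bigr => l _; rewrite /F; congr (_ * (modulus (f (polar r _)) + _)).
  by apply: eq_from_tnth => j; rewrite !tnth_mktuple addrA.
rewrite ge0_integral_sum//; last 2 first.
  by move=> l; apply/measurable_EFinP.
  by move=> l th _; rewrite lee_fin.
have FI l : (mean (fun th => (F l th)%:E) <=
    (c l)%:E * (Hardy1_norm D f + (e * (2 * pi) ^+ n)%:E))%E.
  under eq_integral do rewrite /F EFinM.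
  rewrite ge0_integralZl//; last 3 first.
    by apply/measurable_EFinP; apply: measurable_funD.
    by move=> th _; rewrite lee_fin addr_ge0 ?modulus_ge0// ltW.
    by rewrite lee_fin.
  rewrite lee_wpmul2l ?lee_fin//.
  under eq_integral do rewrite EFinD.
  rewrite ge0_integralD//; last 3 first.
    by move=> th _; rewrite lee_fin modulus_ge0.
    exact/measurable_EFinP.
    by move=> th _; rewrite lee_fin ltW.
  rewrite mean_cst leeD2r//.
  rewrite (@integral_cube_shift R n r (v l) (fun z => (modulus (f z))%:E)).
  - exact: mean_le_Hardy1.
  - by move=> w; rewrite lee_fin modulus_ge0.
  - by apply/measurable_EFinP; exact: measurable_polar.
apply: (le_trans (lee_sum _ (fun l _ => FI l))).
have := Mfin; case: (Hardy1_norm D f) hfin (mean_le_Hardy1 rA) => // M _ M0 _.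
have {}M0 : 0 <= M.
  rewrite -lee_fin; apply: le_trans M0.
  by apply: integral_ge0 => th _; rewrite lee_fin modulus_ge0.
under eq_bigr do rewrite -EFinD -EFinM.
rewrite sumEFin -EFinM -EFinD lee_fin -mulr_suml.
apply: (@le_trans _ _ (k ^+ n * (M + e * (2 * pi) ^+ n))).
  by rewrite ler_wpM2r// addr_ge0// mulr_ge0// ltW.
rewrite mulrDr lerD2l mulrCA /e mulrAC ler_pdivrMr//.
by apply: ler_wpM2l; [exact: ltW|rewrite lerDl].
Qed.

End TorusMeans.

(** * Geometry of complete Reinhardt domains *)

Section Geometry.
Context (R : realType) (n : nat) (D : set (cvec R n)).
Hypothesis hD : complete_Reinhardt D.

Lemma Reinhardt_scale (w z : cvec R n) : D w ->
  (forall j, modulus (z ord0 j) < modulus (w ord0 j)) -> D z.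
Proof.
move=> Dw zw; have [_ scale] := hD.
have w0 j : w ord0 j != 0.
  by rewrite -modulus_eq0 gt_eqF// (le_lt_trans (modulus_ge0 _) (zw j)).
pose lam : cvec R n := \row_j (z ord0 j / w ord0 j).
have <- : \row_k (lam ord0 k * w ord0 k) = z by apply/rowP => j; rewrite !mxE divfK.
apply: scale => // j; rewrite mxE (_ : 1 = (1 : R)%:C%C)// modulus_lt modulusM modulusV.
by rewrite ltr_pdivrMr ?mul1r// (le_lt_trans (modulus_ge0 _) (zw j)).
Qed.

Lemma modulus_polar (r th : n.-tuple R) j : 0 <= tnth r j ->
  modulus (polar r th ord0 j) = tnth r j.
Proof.
by move=> r0; rewrite mxE -[(_ +i* _)%C]/(cis _) modulusM modulus_cis mulr1 modulus_real.
Qed.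

(** Enlarging all the moduli slightly, and then shrinking them by half as much,
    yields a whole torus inside the open set [D]. *)
Lemma mem_Reinhardt z : D z <->
  exists2 r, admissible_radii D r & forall j, modulus (z ord0 j) < tnth r j.
Proof.
split=> [Dz|[r [r0 rD] zr]]; last first.
  apply: (@Reinhardt_scale (polar r [tuple 0 | j < n])); first by apply: rD; eexists.
  by move=> j; rewrite modulus_polar// ltW.
have [[_ oD _] _] := hD.
have [e e0 eD] := open_modulus_ball oD Dz.
pose m j := modulus (z ord0 j).
have /choice[psi psiP] : forall j, exists x, z ord0 j = (m j)%:C%C * cis x.
  by move=> j; have [x _ xE] := polar_form (z ord0 j); exists x.
have m0 j : 0 <= m j by exact: modulus_ge0.
pose w : cvec R n := \row_j ((m j + e / 2)%:C%C * cis (psi j)).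
have w0 j : 0 <= m j + e / 2 by rewrite addr_ge0// divr_ge0// ltW.
have Dw : D w.
  apply: eD => j; rewrite mxE psiP -mulrBl -rmorphB /= opprD addrA subrr sub0r.
  rewrite modulusM modulus_cis mulr1 rmorphN modulusN modulus_real; first by lra.
  by rewrite divr_ge0// ltW.
exists [tuple m j + e / 4 | j < n]; last first.
  by move=> j; rewrite tnth_mktuple ltrDl divr_gt0.
have r0 j : 0 < tnth [tuple m j + e / 4 | j < n] j.
  by rewrite tnth_mktuple ltr_wpDl// divr_gt0.
split => // _ [th _ <-]; apply: (Reinhardt_scale Dw) => j.
rewrite modulus_polar ?(ltW (r0 j))// tnth_mktuple mxE modulusM modulus_cis mulr1.
by rewrite modulus_real// ltrD2l; lra.
Qed.

Lemma modulus_rotate (th : n.-tuple R) (z : cvec R n) j :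
  modulus (rotate th z ord0 j) = modulus (z ord0 j).
Proof. by rewrite mxE modulusM modulus_cis mul1r. Qed.

Lemma rotate_Reinhardt th z : D (rotate th z) <-> D z.
Proof.
by split => /mem_Reinhardt[r rA zr]; apply/mem_Reinhardt; exists r => // j;
  have := zr j; rewrite modulus_rotate.
Qed.

(** Some coordinates of [z] may vanish, so [r] is not an admissible radius in
    general; the torus through [z] can be degenerate. *)
Lemma torus_through (z : cvec R n) : D z ->
  exists r psi, range (polar r) `<=` D /\ forall th,
    rotate th z = polar r [tuple tnth th j + tnth psi j | j < n].
Proof.
move=> Dz; exists [tuple modulus (z ord0 j) | j < n].
have /choice[psi psiP] : forall j, exists x, z ord0 j = (modulus (z ord0 j))%:C%C * cis x.
  by move=> j; have [x _ xE] := polar_form (z ord0 j); exists x.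
exists [tuple psi j | j < n]; split.
  have /mem_Reinhardt[r rA zr] := Dz.
  move=> _ [th _ <-]; apply/mem_Reinhardt; exists r => // j.
  by rewrite modulus_polar tnth_mktuple ?modulus_ge0.
move=> th; apply/rowP => j; rewrite !mxE !tnth_mktuple -[(_ +i* _)%C]/(cis _).
by rewrite cisD mulrCA -psiP.
Qed.

End Geometry.

(** * Torus means of the error *)

Section MeanError.
Context (R : realType) (n : nat) (D : set (cvec R n)) (f : cvec R n -> R[i]^o).
Hypothesis hD : complete_Reinhardt D.
Context (a : multi_index n -> R[i]).
Hypothesis ha : power_series_expansion D f a.
Hypothesis hfin : (Hardy1_norm D f < +oo)%E.
Local Notation angle := (power_measure (@lebesgue_measure R) n).
Local Notation TR := (measurableTypeR R).
Local Notation mean g := (\int[angle]_(th in @cube R n) g th)%E.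
Local Open Scope ereal_scope.

Definition error N (z : cvec R n) : R := modulus (square_partial_sum a N z - f z)%R.

Definition mean_error N z := mean (fun th => (error N (rotate th z))%:E).

Lemma mean_error_ge0 N z : 0 <= mean_error N z.
Proof. by apply: integral_ge0 => th _; rewrite lee_fin modulus_ge0. Qed.

Lemma measurable_error_rotate N z : D z ->
  measurable_fun setT (fun th : n.-tuple TR => error N (rotate th z)).
Proof.
move=> Dz; have := measurable_partial_sum_error ha N (coord_measurable_rotate z).
rewrite (_ : _ @^-1` D = setT)//; apply/seteqP; split => // th _ /=.
exact/rotate_Reinhardt.
Qed.

(** The partial sums converge uniformly on the compact torus through [z]. *)
Lemma mean_error_cvg z : D z -> mean_error N z @[N --> \oo] --> 0.
Proof.
move=> Dz; have [r [psi [rD rE]]] := torus_through hD Dz.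
have tp0 : (0 < (2 * pi) ^+ n :> R)%R by rewrite exprn_gt0// mulr_gt0// pi_gt0.
have small (e : R) : (0 < e)%R -> exists N0, forall N, (N0 <= N)%N ->
    mean_error N z <= e%:E.
  move=> e0; have e1 : (0 < e / (2 * pi) ^+ n)%R by rewrite divr_gt0.
  have [N0 N0P] := partial_sums_cvg_on_torus ha rD e1.
  exists N0 => N NN.
  have -> : e%:E = mean (fun=> (e / (2 * pi) ^+ n)%:E).
    by rewrite mean_cst divfK// gt_eqF.
  apply: ge0_le_integral => //.
  - exact: measurable_cube.
  - by move=> th _; rewrite lee_fin modulus_ge0.
  - apply/measurable_EFinP; apply: measurable_funS (measurable_error_rotate N Dz) => //.
  - by move=> th _; rewrite lee_fin /error rE; apply/ltW/N0P.
have fin : exists N0, forall N, (N0 <= N)%N -> mean_error N z \is a fin_num.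
  have [N0 N0P] := small 1%R ltr01; exists N0 => M MN.
  by rewrite ge0_fin_numE ?mean_error_ge0// (le_lt_trans (N0P _ MN)) ?ltry.
apply/fine_cvgP; split.
  by have [N0 N0P] := fin; exists N0.
apply/cvgrPdist_le => e e0; have [N1 N1P] := small e e0.
have [N0 N0P] := fin; exists (maxn N0 N1) => // N /=; rewrite geq_max => /andP[h0 h1].
rewrite sub0r normrN ger0_norm ?fine_ge0 ?mean_error_ge0//.
by rewrite -lee_fin fineK ?N0P// N1P.
Qed.

(** The bound for partial sums holds for [S_N f] and for [S_N0 f]; the latter is
    uniformly close to [f] on the torus through [z] when [N0] is large. *)
Lemma mean_error_le r (q : R) (z : cvec R n) N : admissible_radii D r -> (0 <= q < 1)%R ->
  (forall j, modulus (z ord0 j) < q * tnth r j)%R ->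
  mean_error N z <= (2 * lebesgue_constant q ^+ n)%R%:E * Hardy1_norm D f.
Proof.
move=> rA q01 zr; have [r0 _] := rA; have [q0 q1] := andP q01.
have Dz : D z.
  apply/(mem_Reinhardt hD); exists r => // j; apply: (lt_le_trans (zr j)).
  by rewrite ler_piMl// ltW.
have [r' [psi [rD rE]]] := torus_through hD Dz.
have B K := mean_partial_sum_le ha hfin K rA q01 (fun j => ltW (zr j)).
have tp0 : (0 < (2 * pi) ^+ n :> R)%R by rewrite exprn_gt0// mulr_gt0// pi_gt0.
have mcube := @measurable_cube R n.
apply/lee_addgt0Pr => e e0.
have e1 : (0 < e / (2 * pi) ^+ n)%R by rewrite divr_gt0.
have [N0 N0P] := partial_sums_cvg_on_torus ha rD e1.
have mS K : measurable_fun (@cube R n : set (n.-tuple TR)) (fun th : n.-tuple TR =>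
    (modulus (square_partial_sum a K (rotate th z)))%:E).
  apply/measurable_EFinP; exact: measurable_funS (measurable_partial_sum_rotate a K z).
apply: (@le_trans _ _ (mean (fun th =>
   ((modulus (square_partial_sum a N (rotate th z)))%:E +
    (modulus (square_partial_sum a N0 (rotate th z)))%:E) + (e / (2 * pi) ^+ n)%:E))).
  apply: ge0_le_integral => //.
  - by move=> th _; rewrite lee_fin modulus_ge0.
  - apply/measurable_EFinP; apply: measurable_funS (measurable_error_rotate N Dz) => //.
  - by apply: emeasurable_funD => //; apply: emeasurable_funD.
  move=> th _; rewrite -!EFinD lee_fin /error rE.
  set w := polar _ _; have := N0P N0 (leqnn _) [tuple tnth th j + tnth psi j | j < n]%R.
  rewrite -/w => h.
  have := ler_modulusD (square_partial_sum a N w - square_partial_sum a N0 w)%R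
    (square_partial_sum a N0 w - f w)%R.
  have := ler_modulusD (square_partial_sum a N w) (- square_partial_sum a N0 w)%R.
  by rewrite addrA subrK modulusN => ? ?; lra.
rewrite ge0_integralD//; last 3 first.
  by move=> th _; rewrite -EFinD lee_fin addr_ge0 ?modulus_ge0.
  exact: emeasurable_funD.
  by move=> th _; rewrite lee_fin ltW.
rewrite mean_cst divfK ?gt_eqF// leeD2r//.
rewrite ge0_integralD//; last 2 first.
  by move=> th _; rewrite lee_fin modulus_ge0.
  by move=> th _; rewrite lee_fin modulus_ge0.
apply: le_trans (leeD (B N) (B N0)) _.
have := Hardy1_norm_fin hfin rA; case: (Hardy1_norm D f) => // M _.
by rewrite -!EFinM -EFinD lee_fin -mulrA (mulr_natl _ 2) mulr2n.
Qed.

End MeanError.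

(** * Averaging over rotations *)

Section Averaging.
Context (R : realType) (n : nat) (D : set (cvec R n)) (f : cvec R n -> R[i]^o).
Hypothesis hD : complete_Reinhardt D.
Context (a : multi_index n -> R[i]).
Hypothesis ha : power_series_expansion D f a.
Local Notation angle := (power_measure (@lebesgue_measure R) n).
Local Notation volume := (power_measure (@plane_lebesgue R) n).
Local Notation TR := (measurableTypeR R).
Local Notation TP := (TR * TR)%type.
Local Notation P := (@of_real_coords R n @^-1` D : set (n.-tuple TP)).
Local Open Scope ereal_scope.

Lemma coord_measurable_of_real_coords :
  coord_measurable (fun t : n.-tuple TP => of_real_coords t).
Proof.
have mtn j := @measurable_tnth _ TP n j.
move=> j; split.
  apply: (eq_measurable_fun (fun t : n.-tuple TP => (tnth t j).1)) => [t _|].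
    by rewrite mxE.
  exact: measurableT_comp (mtn j).
apply: (eq_measurable_fun (fun t : n.-tuple TP => (tnth t j).2)) => [t _|].
  by rewrite mxE.
exact: measurableT_comp (mtn j).
Qed.

Lemma measurable_domain : measurable P.
Proof.
have [[_ oD _] _] := hD.
exact: measurable_open_preimage oD coord_measurable_of_real_coords.
Qed.

Definition rotate_coords (th : n.-tuple TR) (t : n.-tuple TP) : n.-tuple TP :=
  tuple_map (fun j => plane_rotation (cos (tnth th j)) (sin (tnth th j))) t.

Lemma of_real_coords_rotate th t :
  of_real_coords (rotate_coords th t) = rotate th (of_real_coords t).
Proof.
apply/rowP => j; rewrite !mxE !tnth_mktuple; apply/eqP; rewrite eq_complex /=.
by apply/andP; split => //; rewrite addrC.
Qed.

Lemma measurable_rotate_coords :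
  measurable_fun setT (fun p : n.-tuple TR * n.-tuple TP => rotate_coords p.1 p.2).
Proof.
apply/measurable_fun_tnthP => j.
pose c (p : n.-tuple TR * n.-tuple TP) : TR := cos (tnth p.1 j).
pose s (p : n.-tuple TR * n.-tuple TP) : TR := sin (tnth p.1 j).
pose x (p : n.-tuple TR * n.-tuple TP) : TR := (tnth p.2 j).1.
pose y (p : n.-tuple TR * n.-tuple TP) : TR := (tnth p.2 j).2.
have mth : measurable_fun setT (fun p : n.-tuple TR * n.-tuple TP => tnth p.1 j).
  exact: (measurableT_comp (measurable_tnth j) measurable_fst).
have mt : measurable_fun setT (fun p : n.-tuple TR * n.-tuple TP => tnth p.2 j).
  exact: (measurableT_comp (measurable_tnth j) measurable_snd).
have [mc ms] : measurable_fun setT c /\ measurable_fun setT s by exact: (cmeasurable_cis mth).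
have mx : measurable_fun setT x by exact: (measurableT_comp measurable_fst mt).
have my : measurable_fun setT y by exact: (measurableT_comp measurable_snd mt).
rewrite (_ : _ \o _ = fun p => (c p * x p - s p * y p, s p * x p + c p * y p)%R); last first.
  by apply/funext => p /=; rewrite tnth_mktuple.
apply/measurable_fun_pairP; split.
  by apply: measurable_funB; apply: measurable_funM.
by apply: measurable_funD; apply: measurable_funM.
Qed.

Definition error_density N (t : n.-tuple TP) : \bar R :=
  ((fun t => (error f a N (of_real_coords t))%:E) \_ P) t.

Lemma error_density_ge0 N t : 0 <= error_density N t.
Proof. by rewrite /error_density /patch; case: ifP; rewrite ?lee_fin ?modulus_ge0. Qed.

Lemma measurable_error_density N : measurable_fun setT (error_density N).
Proof.
apply/(measurable_restrictT _ measurable_domain)/measurable_EFinP.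
exact: (measurable_partial_sum_error ha N coord_measurable_of_real_coords).
Qed.

Definition rotated_error N (p : n.-tuple TR * n.-tuple TP) : \bar R :=
  error_density N (rotate_coords p.1 p.2) * (\1_(@cube R n) p.1)%:E.

Lemma rotated_error_ge0 N p : 0 <= rotated_error N p.
Proof. by rewrite mule_ge0 ?error_density_ge0// lee_fin. Qed.

Lemma measurable_rotated_error N : measurable_fun setT (rotated_error N).
Proof.
apply: emeasurable_funM.
  exact: (measurableT_comp (measurable_error_density N) measurable_rotate_coords).
apply/measurable_EFinP.
have m1 : measurable_fun setT (\1_(@cube R n) : n.-tuple TR -> R).
  by apply: measurable_indic; exact: measurable_cube.
exact: (measurableT_comp m1 measurable_fst).
Qed.

Definition rotation_mean N (t : n.-tuple TP) : \bar R :=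
  \int[angle]_th rotated_error N (th, t).

Lemma measurable_rotation_mean N : measurable_fun setT (rotation_mean N).
Proof.
apply: (measurable_fun_fubini_tonelli_G (rotated_error N)) => //.
  exact: measurable_rotated_error.
exact: rotated_error_ge0.
Qed.

Lemma rotation_meanE N t :
  rotation_mean N t = if t \in P then mean_error f a N (of_real_coords t) else 0.
Proof.
have inP th : (rotate_coords th t \in P) = (t \in P).
  apply/idP/idP; rewrite !inE /= of_real_coords_rotate; by move/(rotate_Reinhardt hD).
rewrite /rotation_mean /rotated_error /error_density.
case: ifPn => tP; last first.
  by apply: integral0_eq => th _; rewrite /patch inP (negPf tP) mul0e.
rewrite /mean_error [RHS]integral_mkcond; apply: eq_integral => th _.
rewrite /patch inP tP /= indicE of_real_coords_rotate.
by case: (th \in _); rewrite ?mule1 ?mule0.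
Qed.

(** For every rotation the integral of the error over the invariant domain is the
    same; integrate over the angles and exchange the integrals by Tonelli's
    theorem. *)
Lemma Bergman1_average N :
  Bergman1_norm D (fun z => square_partial_sum a N z - f z)%R * ((2 * pi) ^+ n)%R%:E =
  \int[volume]_t rotation_mean N t.
Proof.
rewrite /rotation_mean -(fubini_tonelli (m1 := angle) (m2 := volume) (rotated_error N)); last 2 first.
- exact: measurable_rotated_error.
- exact: rotated_error_ge0.
have inner th : \int[volume]_t rotated_error N (th, t) =
    Bergman1_norm D (fun z => square_partial_sum a N z - f z)%R * (\1_(@cube R n) th)%:E.
  rewrite /rotated_error /=.
  have mrot : measurable_fun setT (rotate_coords th).
    by apply: measurable_tuple_map => j; exact: measurable_plane_rotation.
  rewrite ge0_integralZr//; last 2 first.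
  - exact: (measurableT_comp (measurable_error_density N) mrot).
  - by move=> t _; exact: error_density_ge0.
  congr (_ * _).
  rewrite (@ge0_integral_scales_measure _ _ _ volume (1%:nng)%R (rotate_coords th)
    (error_density N))//.
  - by rewrite mul1e /Bergman1_norm [RHS]integral_mkcond.
  - have := @power_measure_scales _ TP R (@plane_lebesgue R) (1%:nng)%R n
      (fun j => plane_rotation (cos (tnth th j)) (sin (tnth th j))).
    rewrite /= expr1n; apply => j; first exact: measurable_plane_rotation.
    by apply: plane_rotation_preserves; exact: cos2Dsin2.
  - exact: measurable_error_density.
  - exact: error_density_ge0.
under eq_integral do rewrite inner.
rewrite ge0_integralZl//; last 2 first.
- apply/measurable_EFinP; apply: measurable_indic; exact: measurable_cube.
- apply: integral_ge0 => t _; rewrite lee_fin; exact: modulus_ge0.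
congr (_ * _); rewrite integral_indic ?setIT//; last exact: measurable_cube.
exact/esym/cube_volume.
Qed.

End Averaging.

(** * Numerical bounds for the shells *)

Section Numeric.
Context (R : realType).

Lemma bernoulli (y : R) k : -1 <= y -> 1 + k%:R * y <= (1 + y) ^+ k.
Proof.
move=> y1; elim: k => [|k IH]; first by rewrite mul0r addr0 expr0.
have y0 : 0 <= 1 + y by lra.
rewrite exprSr; apply: le_trans (ler_wpM2r y0 IH).
have := mulr_ge0 (ler0n R k) (sqr_ge0 y); rewrite -natr1; nra.
Qed.

(** With [y] of order [1 / n], the Bernoulli inequality gives
    [k + 3 <= (3 + 1 / y) (1 + y)^k] and keeps [(1 + y)^n] below [3 / 2]. *)
Lemma power_le_geometric n : exists2 C : R, 0 <= C &
  forall k, (k%:R + 3) ^+ n <= C * (3 / 2) ^+ k.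
Proof.
(* [n y <= 1 / 3], hence [(1 - y)^n >= 2 / 3] *)
pose y : R := (3 * n.+1%:R)^-1.
have y0 : 0 < y by rewrite invr_gt0 mulr_gt0.
have ny : n%:R * y <= 1 / 3.
  by rewrite /y ler_pdivrMr ?mulr_gt0// mulrA div1r mulVf ?pnatr_eq0// mul1r ler_nat.
have y1 : y <= 1 / 3.
  by rewrite /y -div1r ler_pdivrMr ?mulr_gt0// mulrA div1r mulVf ?pnatr_eq0// mul1r ler1n.
have yn : (1 + y) ^+ n <= 3 / 2.
  have a1 : 2 / 3 <= (1 - y) ^+ n.
    by apply: le_trans (bernoulli n _); [rewrite mulrN|]; lra.
  have a2 : (1 + y) ^+ n * (1 - y) ^+ n <= 1.
    by rewrite -exprMn exprn_ile1//; nra.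
  have a3 : 0 <= (1 + y) ^+ n by rewrite exprn_ge0//; lra.
  by nra.
exists ((3 + y^-1) ^+ n) => [|k].
  by rewrite exprn_ge0// addr_ge0// invr_ge0 ltW.
have yn0 : 0 <= (1 + y) ^+ n by rewrite exprn_ge0//; lra.
apply: (@le_trans _ _ (((3 + y^-1) * (1 + y) ^+ k) ^+ n)).
  have y3 : 0 <= 3 + y^-1 by rewrite addr_ge0// invr_ge0 ltW.
  apply: lerXn2r.
  - by rewrite nnegrE addr_ge0.
  - by rewrite nnegrE mulr_ge0// exprn_ge0// addr_ge0// ltW.
  have yk : -1 <= y by lra.
  apply: le_trans (ler_wpM2l y3 (bernoulli k yk)).
  have -> : (3 + y^-1) * (1 + k%:R * y) = 3 + k%:R + y^-1 + 3 * k%:R * y.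
    by field; rewrite gt_eqF.
  have := mulr_ge0 (ler0n R k) (ltW y0); have : 0 <= y^-1 by rewrite invr_ge0 ltW.
  by move=> ? ?; lra.
rewrite exprMn; apply: ler_wpM2l.
  by rewrite exprn_ge0// addr_ge0// invr_ge0 ltW.
rewrite -exprM mulnC exprM; by apply: lerXn2r; rewrite ?nnegrE//; lra.
Qed.

Definition shell_radius k : R := 1 - 2^-1 ^+ k.

Lemma shell_radius01 k : 0 <= shell_radius k < 1.
Proof.
by rewrite /shell_radius subr_ge0 exprn_ile1//= ?gtrBl ?exprn_gt0//; lra.
Qed.

Lemma shell_radiusS_gt0 k : 0 < shell_radius k.+1.
Proof.
rewrite /shell_radius subr_gt0 exprS; have : 2^-1 ^+ k <= 1 :> R by apply: exprn_ile1; lra.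
have : 0 < 2^-1 ^+ k :> R by rewrite exprn_gt0//; lra.
lra.
Qed.

Lemma shell_radius_cvg (x : R) : x < 1 -> exists k, x < shell_radius k.+1.
Proof.
move=> x1; pose k := Num.truncn (1 - x)^-1.
have x0 : 0 < 1 - x by rewrite subr_gt0.
exists k; rewrite /shell_radius ltrBrDr -ltrBrDl exprVn.
have k1 : (1 - x)^-1 < k.+1%:R by exact: truncnS_gt.
have k2 : k.+1%:R <= 2 ^+ k.+1 :> R.
  by rewrite -natrX ler_nat ltnW// ltn_expl.
rewrite -[ltRHS]invrK ltf_pV2 ?posrE ?exprn_gt0 ?invr_gt0//.
exact: lt_le_trans k2.
Qed.

Lemma shell_radius_le k l : (k <= l)%N -> shell_radius k <= shell_radius l.
Proof.
by move=> kl; rewrite lerD2l lerN2 ler_wiXn2l//; lra.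
Qed.

Lemma lebesgue_constant_shell k :
  lebesgue_constant (shell_radius k.+1) <= 8 * (k%:R + 3).
Proof.
rewrite ler_wpM2l// /shell_radius opprB addrCA subrr addr0 exprVn invrK.
have -> : k%:R + 3 = 1 + k.+2%:R :> R by rewrite -addn2 natrD; ring.
rewrite lerD2l.
apply: (@le_trans _ _ (ln (2 ^+ k.+2))).
  have p1 : 0 < 1 + 2 ^+ k.+1 :> R by rewrite addr_gt0// exprn_gt0.
  rewrite ler_ln ?posrE ?exprn_gt0//.
  by rewrite [leRHS]exprS mulr2n mulrDl mul1r lerD2r exprn_ege1// lerDl.
rewrite lnXn// lerMn2r /=.
by apply: (@le_ln1Dx R 1); lra.
Qed.

End Numeric.

(** * Volume of the shells *)

Section Volume.
Context (R : realType) (n : nat) (D : set (cvec R n)).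
Hypothesis hD : complete_Reinhardt D.
Hypothesis hb : bounded_set D.
Local Notation volume := (power_measure (@plane_lebesgue R) n).
Local Notation TR := (measurableTypeR R).
Local Notation TP := (TR * TR)%type.
Local Notation P := (@of_real_coords R n @^-1` D : set (n.-tuple TP)).

(** The points whose dilation by [1 / q] lies in the domain, that is, [q D]. *)
Definition dilated (q : R) : set (n.-tuple TP) :=
  tuple_map (fun=> plane_dilation q) @^-1` P.

Lemma measurable_dilated q : measurable (dilated q).
Proof.
rewrite -[X in measurable X]setTI; apply: measurable_tuple_map => //.
  by move=> _; exact: measurable_plane_dilation.
exact: measurable_domain.
Qed.

(** This is the form in which [mean_error_le] applies. *)
Lemma dilatedP q t : 0 < q -> dilated q t <->
  exists2 r, admissible_radii D r &
    forall j, modulus (of_real_coords t ord0 j) < q * tnth r j.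
Proof.
move=> q0; have mE j : modulus (of_real_coords (tuple_map (fun=> plane_dilation q) t) ord0 j) =
    q^-1 * modulus (of_real_coords t ord0 j).
  have <- : modulus (q^-1%:C)%C = q^-1 by rewrite modulus_real// invr_ge0 ltW.
  rewrite -modulusM !mxE tnth_mktuple; congr modulus; apply/eqP.
  by rewrite eq_complex /= !mul0r subr0 addr0 !eqxx.
rewrite /dilated /=; split=> [/(mem_Reinhardt hD)[r rA zr]|[r rA zr]].
  by exists r => // j; have := zr j; rewrite mE ltr_pdivrMl.
by apply/(mem_Reinhardt hD); exists r => // j; rewrite mE ltr_pdivrMl.
Qed.

Lemma volume_domain_fin : (volume P < +oo)%E.
Proof.
have [B BP] : exists B : R, forall z : cvec R n, D z -> forall j, modulus (z ord0 j) <= B.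
  have [B0 [rB0 B0P]] := hb.
  have B0lt : B0 < `|B0| + 1 by rewrite (le_lt_trans (real_ler_norm rB0))// ltrDl.
  pose B1 : R[i] := `|B0| + 1 + 1.
  have B1E : B1 = (modulus B0 + 1 + 1)%:C%C by rewrite /B1 modulusE !rmorphD.
  exists (modulus B0 + 1 + 1) => z Dz j.
  have zB : `|(0 : cvec R n) - z| < B1.
    by rewrite sub0r normrN (le_lt_trans (B0P _ B0lt z Dz))// ltrDl.
  have : ball (0 : cvec R n) B1 z by rewrite mx_norm_ball.
  move=> [_ /(_ ord0 j)]; rewrite /ball /= /ball_ mxE sub0r normrN B1E modulus_lt.
  exact: ltW.
pose A : set TP := `[- B, B]%classic `*` `[- B, B]%classic.
have mA : measurable A by apply: measurableX; exact: measurable_itv.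
have PA : P `<=` [set t | forall i, A (tnth t i)].
  move=> t Dt j; have := BP _ Dt j; rewrite mxE => h.
  by split => /=; rewrite in_itv /= -ler_norml; apply: le_trans h;
    [exact: (modulus_ge_Re ((tnth t j).1 +i* (tnth t j).2)%C)
    |exact: (modulus_ge_Im ((tnth t j).1 +i* (tnth t j).2)%C)].
have mE := @power_measureE _ TP R (@plane_lebesgue R) n (fun=> A) (fun=> mA).
have mbox : measurable [set t : n.-tuple TP | forall i, A (tnth t i)].
  rewrite (_ : [set _ | _] = \bigcap_(j in [set: 'I_n]) ((@tnth n TP)^~ j @^-1` A)).
    apply: fin_bigcap_measurable => // j _.
    by rewrite -[X in measurable X]setTI; exact: measurable_tnth.
  by apply/seteqP; split => [t H j _|t H j]; [exact: H|exact: H].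
apply: (@le_lt_trans _ _ (volume [set t | forall i, A (tnth t i)])).
  by apply: le_measure; rewrite ?inE//; exact: measurable_domain.
rewrite mE; have Afin : exists x : R, plane_lebesgue A = x%:E.
  have itvfin : @lebesgue_measure R `[- B, B]%classic \is a fin_num.
    by have := @lebesgue_measure_itv R `[- B, B]; rewrite /= => ->; case: ifP.
  have bE := fineK itvfin; set b := fine _ in bE; exists (b * b).
  rewrite EFinM bE; apply: product_measure1E; exact: measurable_itv.
have [x xE] := Afin.
rewrite (eq_bigr (fun=> x%:E)) => [|i _]; last exact: xE.
by rewrite prodEFin ltry.
Qed.

Lemma volume_dilated q : 0 < q -> volume (dilated q) = (((q ^+ 2) ^+ n)%:E * volume P)%E.
Proof.
move=> q0; have q20 : 0 <= q ^+ 2 by rewrite sqr_ge0.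
have := @power_measure_scales _ TP R (@plane_lebesgue R) (NngNum q20) n
  (fun=> plane_dilation q).
apply; last exact: measurable_domain.
- by move=> _; exact: measurable_plane_dilation.
- by move=> _; exact: plane_dilation_scales.
Qed.

(** The shell with index [0] is the whole domain: [shell_radius 0 = 0], and a
    dilation with ratio [0^-1 = 0] would make [dilated 0] everything. *)
Definition shell k : set (n.-tuple TP) :=
  P `\` (if k is 0 then set0 else dilated (shell_radius R k)).

Lemma measurable_shell k : measurable (shell k).
Proof.
apply: measurableD; first exact: measurable_domain.
by case: k => // k; exact: measurable_dilated.
Qed.

(** Dilation by [q] multiplies volumes by [q^(2n)], and
    [1 - (1 - x)^(2n) <= 2 n x]. *)
Lemma volume_shell_le k :
  (volume (shell k) <= ((2 * n%:R + 1) * 2^-1 ^+ k * fine (volume P))%:E)%E.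
Proof.
have Pfin : volume P \is a fin_num by rewrite ge0_fin_numE// volume_domain_fin.
have mP := measurable_domain hD.
have V0 : 0 <= fine (volume P) by rewrite fine_ge0.
case: k => [|k]; rewrite /shell.
  by rewrite setD0 expr0 mulr1 -[leLHS]fineK// lee_fin ler_peMl// lerDr.
have q0 := shell_radiusS_gt0 R k; have /andP[_ q1] := shell_radius01 R k.+1.
set q := shell_radius R k.+1 in q0 q1 *.
have qP : dilated q `<=` P.
  move=> t /(dilatedP _ q0)[r rA zr]; apply/(mem_Reinhardt hD); exists r => // j.
  have [r0 _] := rA; apply: (lt_le_trans (zr j)).
  by rewrite ler_piMl// ltW.
have -> : volume (P `\` dilated q) = (volume P - volume (dilated q))%E.
  rewrite measureD; [|exact: mP|exact: measurable_dilated|exact: volume_domain_fin].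
  by rewrite setIidr.
rewrite (volume_dilated q0) -(fineK Pfin) -EFinM -EFinB lee_fin.
rewrite -exprM; set V := fine _ in V0 *.
have := @bernoulli R (- 2^-1 ^+ k.+1) (2 * n).
rewrite -[1 + - _]/q => /(_ _) h.
have {}h : 1 - (2 * n)%:R * 2^-1 ^+ k.+1 <= q ^+ (2 * n).
  rewrite -mulrN; apply: h; rewrite lerN2 exprn_ile1//; lra.
have e0 : 0 <= 2^-1 ^+ k.+1 :> R by rewrite exprn_ge0.
rewrite -[X in X - _]mul1r -mulrBl ler_wpM2r//.
by move: h; rewrite natrM; lra.
Qed.

(** Take the smallest [k] for which [t] is in the dilate of radius [1 - 2^-(k+1)]. *)
Lemma mem_shell t : P t -> exists k, shell k t /\ dilated (shell_radius R k.+1) t.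
Proof.
move=> Pt.
have ex : exists k, `[< dilated (shell_radius R k.+1) t >].
  have [r rA zr] := (mem_Reinhardt hD _).1 Pt; have [r0 _] := rA.
  have /choice[k kP] : forall j, exists k,
      modulus (of_real_coords t ord0 j) / tnth r j < shell_radius R k.+1.
    by move=> j; apply: shell_radius_cvg; rewrite ltr_pdivrMr// mul1r.
  exists (\max_j k j)%N; apply/asboolP/(dilatedP _ (shell_radiusS_gt0 _ _)).
  exists r => // j; rewrite -ltr_pdivrMr//; apply: (lt_le_trans (kP j)).
  by apply: shell_radius_le; rewrite ltnS; exact: leq_bigmax.
case: (ex_minnP ex) => k /asboolP kt kmin; exists k; split => //; split => //.
case: k kt kmin => [_ _ []|k _ kmin kt'].
by have := kmin k; rewrite ltnn => /(_ (asboolT kt')).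
Qed.

End Volume.

(** * Integrable majorant *)

Section Domination.
Context (R : realType) (n : nat) (D : set (cvec R n)) (f : cvec R n -> R[i]^o).
Hypothesis hD : complete_Reinhardt D.
Hypothesis hb : bounded_set D.
Context (a : multi_index n -> R[i]).
Hypothesis ha : power_series_expansion D f a.
Hypothesis hfin : (Hardy1_norm D f < +oo)%E.
Local Notation volume := (power_measure (@plane_lebesgue R) n).
Local Notation TR := (measurableTypeR R).
Local Notation TP := (TR * TR)%type.
Local Notation P := (@of_real_coords R n @^-1` D : set (n.-tuple TP)).
Local Open Scope ereal_scope.

Definition shell_bound k : R :=
  (2 * lebesgue_constant (shell_radius R k.+1) ^+ n * fine (Hardy1_norm D f))%R.

(** Each point of the domain lies in the shell whose bound controls its torus means
    ([mem_shell]); that the shells overlap only enlarges the sum. *)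
Definition majorant (t : n.-tuple TP) : \bar R :=
  \sum_(0 <= k <oo) (shell_bound k * \1_(shell D k) t)%:E.

Let Hardy1_norm_finite : Hardy1_norm D f \is a fin_num.
Proof.
have [[[z Dz] _ _] _] := hD; have [r rA _] := (mem_Reinhardt hD z).1 Dz.
exact: (Hardy1_norm_fin hfin rA).
Qed.

Let fine_Hardy1_norm_ge0 : (0 <= fine (Hardy1_norm D f))%R.
Proof.
have [[[z Dz] _ _] _] := hD; have [r rA _] := (mem_Reinhardt hD z).1 Dz.
apply: fine_ge0; apply: le_trans (mean_le_Hardy1 f rA).
by apply: integral_ge0 => th _; rewrite lee_fin modulus_ge0.
Qed.

Lemma shell_bound_ge0 k : (0 <= shell_bound k)%R.
Proof.
have /andP[_ q1] := shell_radius01 R k.+1.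
by rewrite mulr_ge0// mulr_ge0// exprn_ge0// lebesgue_constant_ge0.
Qed.

Let term_ge0 k t : 0 <= (shell_bound k * \1_(shell D k) t)%:E.
Proof. by rewrite lee_fin mulr_ge0// shell_bound_ge0. Qed.

Let measurable_term k :
  measurable_fun setT (fun t : n.-tuple TP => (shell_bound k * \1_(shell D k) t)%:E).
Proof.
apply/measurable_EFinP; apply: measurable_funM => //.
by apply: measurable_indic; exact: measurable_shell.
Qed.

Lemma rotation_mean_le_majorant N t : rotation_mean D f a N t <= majorant t.
Proof.
rewrite rotation_meanE//; case: ifPn => [|_]; last exact: nneseries_ge0.
rewrite inE => Pt; have [k [st dt]] := mem_shell hD Pt.
have [r rA zr] := (dilatedP hD t (shell_radiusS_gt0 R k)).1 dt.
apply: le_trans (mean_error_le hD ha hfin N rA (shell_radius01 R k.+1) zr) _.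
rewrite -(fineK Hardy1_norm_finite) -EFinM -/(shell_bound k).
have nd := @nneseries_lim_ge R
  (fun k => (shell_bound k * \1_(shell D k) t)%:E) xpredT 0 k.+1
  (fun i _ _ => term_ge0 i t).
apply: le_trans nd.
rewrite big_mkord big_ord_recr /= indicE mem_set// mulr1.
by rewrite leeDr// sume_ge0.
Qed.

(** The bound on the shell [k] grows like [k^n], its volume decreases like [2^-k];
    the product is dominated by the geometric series of ratio [3 / 4]. *)
Lemma integral_majorant_fin : \int[volume]_t majorant t < +oo.
Proof.
rewrite integral_nneseries//.
have [C C0 CP] := power_le_geometric R n.
pose V := fine (volume P); have V0 : (0 <= V)%R by rewrite fine_ge0.
pose M := fine (Hardy1_norm D f).
pose B := (2 * (8 ^+ n * C) * M * ((2 * n%:R + 1) * V))%R.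
have B0 : (0 <= B)%R by rewrite /B !mulr_ge0// ?exprn_ge0// addr_ge0// mulr_ge0.
have term k : \int[volume]_t (shell_bound k * \1_(shell D k) t)%:E <=
    (B * (3 / 4) ^+ k)%:E.
  under eq_integral do rewrite EFinM.
  rewrite ge0_integralZl//; last 2 first.
    apply/measurable_EFinP; apply: measurable_indic; exact: measurable_shell.
    by rewrite lee_fin shell_bound_ge0.
  rewrite integral_indic ?setIT//; last exact: measurable_shell.
  have := @lee_wpmul2l R (shell_bound k)%:E _ _ _ (volume_shell_le hD hb k).
  rewrite lee_fin shell_bound_ge0 => /(_ isT) h; apply: (le_trans h).
  rewrite -EFinM lee_fin -/V.
  have /andP[_ q1] := shell_radius01 R k.+1.
  have k1 : (lebesgue_constant (shell_radius R k.+1) ^+ n <= 8 ^+ n * (C * (3 / 2) ^+ k))%R.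
    apply: (@le_trans _ _ ((8 * (k%:R + 3)) ^+ n)%R).
      apply: lerXn2r; rewrite ?nnegrE ?lebesgue_constant_ge0//.
      exact: lebesgue_constant_shell.
    by rewrite exprMn ler_wpM2l// exprn_ge0.
  have -> : (B * (3 / 4) ^+ k = 2 * (8 ^+ n * (C * (3 / 2) ^+ k)) * M *
      ((2 * n%:R + 1) * 2^-1 ^+ k * V))%R.
    have -> : (3 / 4 = (3 / 2) * 2^-1 :> R)%R by field.
    by rewrite exprMn /B; ring.
  rewrite /shell_bound -/M ler_wpM2r//.
    by rewrite mulr_ge0// mulr_ge0 ?addr_ge0 ?mulr_ge0// exprn_ge0.
  by rewrite ler_wpM2r// ler_wpM2l.
apply: (@le_lt_trans _ _ (4 * B)%:E); last by rewrite ltry.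
apply: lime_le.
  by apply: is_cvg_nneseries => k _ _; exact: integral_ge0.
apply: nearW => m; apply: (@le_trans _ _ (4 * B * (1 - (3 / 4) ^+ m))%:E).
  elim: m => [|m IH]; first by rewrite big_nil expr0 subrr mulr0.
  rewrite big_nat_recr//=; apply: le_trans (leeD IH (term m)) _.
  by rewrite -EFinD lee_fin exprS; lra.
rewrite lee_fin -[leRHS]mulr1 ler_wpM2l ?mulr_ge0// gerBl exprn_ge0//.
Qed.

Lemma integrable_majorant : volume.-integrable setT majorant.
Proof.
apply/integrableP; split; first exact: ge0_emeasurable_sum.
rewrite (eq_integral majorant) ?integral_majorant_fin// => t _.
by rewrite gee0_abs//; exact: nneseries_ge0.
Qed.

Lemma integral_rotation_mean_cvg :
  \int[volume]_t rotation_mean D f a N t @[N --> \oo] --> 0.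
Proof.
have [|||||_ _] := @dominated_convergence _ _ R volume setT measurableT
  (rotation_mean D f a) (cst 0) majorant.
- by move=> N; exact: measurable_rotation_mean.
- exact: measurable_cst.
- apply: aeW => t _; have [tP|tP] := boolP (t \in P).
    rewrite (_ : _ ^~ t = fun N => mean_error f a N (of_real_coords t)).
      by apply: (mean_error_cvg hD ha); rewrite inE in tP.
    by apply/funext => N; rewrite rotation_meanE// tP.
  rewrite (_ : _ ^~ t = fun=> 0); first exact: cvg_cst.
  by apply/funext => N; rewrite rotation_meanE// (negPf tP).
- exact: integrable_majorant.
- apply: aeW => t N _; rewrite gee0_abs ?rotation_mean_le_majorant//.
  rewrite rotation_meanE//; case: ifP => // _; exact: mean_error_ge0.
by rewrite integral0.
Qed.

End Domination.

Theorem corollary3p11 (R : realType) (n : nat) (hn : (0 < n)%N)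
    (D : set (cvec R n)) (hD : complete_Reinhardt D) (hb : bounded_set D)
    (f : cvec R n -> R[i]^o) (hf : Hardy1 D f)
    (a : multi_index n -> R[i]) (ha : power_series_expansion D f a) :
  (fun N : nat => Bergman1_norm D (fun z => square_partial_sum a N z - f z))
    @ \oo --> 0%E.
Proof.
have [_ hfin] := hf.
have tp0 : (2 * pi) ^+ n != 0 :> R.
  by rewrite expf_neq0// mulf_neq0// gt_eqF// pi_gt0.
have -> : (fun N : nat => Bergman1_norm D (fun z => square_partial_sum a N z - f z)) =
    (fun N => (((2 * pi) ^+ n)^-1%:E *
      \int[power_measure (@plane_lebesgue R) n]_t rotation_mean D f a N t)%E).
  apply/funext => N; rewrite -(Bergman1_average hD ha) [in RHS]muleC -muleA.
  by rewrite -EFinM mulfV// mule1.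
rewrite -[X in _ --> X](mule0 ((2 * pi) ^+ n)^-1%:E).
by apply: cvgeZl => //; exact: integral_rotation_mean_cvg.
Qed.
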